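(* Let $n\geqslant 1$ and $t\geqslant 1$ be integers, let $q\in[n]$, let $A_1,\ldots,A_t\subseteq[n]\setminus\{q\}$ be pairwise disjoint, and let $c_1,\ldots,c_t\geqslant 0$ be real numbers. Set $C=\sum_{i=1}^t c_i|A_i|$. Then, in $\mathbb C[\mathfrak S_n]$, \[ C\sum_{j=1}^t c_j\bigl(\alpha_{A_j\cup\{q\}}-\alpha_{A_j}\bigr)\succeq \sum_{i=1}^t c_i^2\alpha_{A_i}+\sum_{1\leqslant i<j\leqslant t}c_ic_j\bigl(\alpha_{A_i\cup A_j}-\alpha_{A_i}-\alpha_{A_j}\bigr). \]
   Context: Let $[n]=\{1,\ldots,n\}$ and let $1$ be the identity of $\mathbb C[\mathfrak S_n]$. For $A\subseteq[n]$ regard $\mathfrak S_A$ as the subgroup of $\mathfrak S_n$ fixing the complement of $A$. For nonempty $A\subseteq[n]$ define \[ \alpha_A=\frac{1}{(|A|-1)!}\sum_{\sigma\in\mathfrak S_A}(1-\sigma)\in\mathbb C[\mathfrak S_n],\] and put $\alpha_\varnothing=0$. Let $*$ be the antilinear involution on $\mathbb C[\mathfrak S_n]$ with $\sigma^*=\sigma^{-1}$. For self-adjoint $A,B\in\mathbb C[\mathfrak S_n]$, write $A\succeq 0$ if $\rho(A)$ is positive semidefinite in every (finite-dimensional) unitary representation $\rho$ of $\mathfrak S_n$, and $A\succeq B$ if $A-B\succeq 0$. *)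

(* Defs.v *)
From mathcomp Require Import all_boot all_order all_algebra all_fingroup.
From mathcomp Require Import all_character.
From mathcomp Require Import complex.
From mathcomp Require Import reals.

Set Implicit Arguments.
Unset Strict Implicit.
Unset Printing Implicit Defensive.

Import GRing.Theory Num.Theory.
Local Open Scope ring_scope.
Local Open Scope sesquilinear_scope.
Local Open Scope complex_scope.

(* The complex group algebra of 'S_n: the formal combination
   \sum_s (a s) s is the finite function a.  Only its linear structure, its
   involution and its action in representations are needed, so no
   multiplication is defined.  The regular module R[i]^o makes the scalars of
   the library's function module range over R[i]. *)
Definition galg (R : realType) (n : nat) : Type := {ffun 'S_n -> R[i]^o}.

Definition gbasis (R : realType) (n : nat) (s : 'S_n) : galg R n :=
  [ffun u => (u == s)%:R].

Definition gstar (R : realType) (n : nat) (a : galg R n) : galg R n :=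
  [ffun s => (a (s^-1)%g)^*].

Definition selfadjoint (R : realType) (n : nat) (a : galg R n) : Prop :=
  gstar a = a.

(* In 'S_n, (s * t)%g applies s first.  With the other convention, the unitary
   representations are those below precomposed with s |-> s^-1. *)
Definition repr_galg (R : realType) (n d : nat)
    (rho : mx_representation R[i] [set: 'S_n] d) (a : galg R n) : 'M[R[i]]_d :=
  \sum_(s : 'S_n) a s *: rho s.

Definition unitary_repr (R : realType) (n d : nat)
    (rho : mx_representation R[i] [set: 'S_n] d) : Prop :=
  forall s : 'S_n, rho s \is unitarymx.

Definition psdmx (R : realType) (d : nat) (M : 'M[R[i]]_d) : Prop :=
  M \is hermsymmx /\ forall v : 'cV[R[i]]_d, 0 <= (v^t* *m M *m v) 0 0.

Definition galg_psd (R : realType) (n : nat) (a : galg R n) : Prop :=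
  forall (d : nat) (rho : mx_representation R[i] [set: 'S_n] d),
    unitary_repr rho -> psdmx (repr_galg rho a).

(* The relation is meant for self-adjoint arguments only; requiring this here
   makes every use of it also assert that it is well formed. *)
Definition galg_ge (R : realType) (n : nat) (a b : galg R n) : Prop :=
  [/\ selfadjoint a, selfadjoint b & galg_psd (a - b)].

(* Sym A is the subgroup of the permutations fixing the complement of A. *)
Definition alpha (R : realType) (n : nat) (A : {set 'I_n}) : galg R n :=
  if A == set0 then 0
  else ((#|A| - 1)`!%:R)^-1 *: \sum_(s in Sym A) (gbasis R 1%g - gbasis R s).

(* Main.v *)
(* Write P_B for the projection onto the vectors fixed by the permutations
   supported in B, so that alpha_B acts as |B| (1 - P_B).  Every P_{A_k} commutes
   with all terms of the inequality.  On the kernel of P_{A_k} the terms involving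
   A_k are a sum of nonnegative operators, and one may replace c_k by 0; so it
   suffices to treat vectors fixed by every P_{A_k} with c_k nonzero.  There the
   left-hand side is that of the octopus inequality of Caputo, Liggett and
   Richthammer for the point weights c_i on A_i, and the right-hand side is at most
   the octopus one because |B| (1 - P_B) is bounded by the sum of 1 - tau over the
   transpositions tau of B.

   The octopus inequality says that W = sum_{x,y} b_x b_y (x y) >= 0 when the
   weights b sum to 0 and only b_q may be negative.  With N = sum_x b_x^2,
     12 N W = 6 W^2 - sum over distinct x, y, z, w of b_x b_y b_z b_w K(x,y,z,w),
   where K is 12 times the projection onto the vectors fixed by the Klein group of
   {x,y,z,w} and orthogonal to those fixed by its alternating group: modulo
   functions of three of the four points, which sum to 0, this is an identity for
   each tuple.  Eliminating b_q turns the last sum into a positive combination of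
     K(q,y,z,w) + K(x,q,z,w) + K(x,y,q,w) + K(x,y,z,q) - K(x,y,z,w) >= 0. *)

Require Import Defs.
From mathcomp Require Import all_boot all_order all_algebra all_fingroup.
From mathcomp Require Import all_character.
From mathcomp Require Import complex.
From mathcomp Require Import reals.
From mathcomp Require Import ring.

Set Implicit Arguments.
Unset Strict Implicit.
Unset Printing Implicit Defensive.

Import Order.TTheory GRing.Theory Num.Theory.
Local Open Scope ring_scope.

(** * Three-cycles and double transpositions *)

(* Products of permutations apply the left factor first: this is
   a -> b -> c -> a. *)
Definition cyc3 (T : finType) (a b c : T) : {perm T} := (tperm a b * tperm a c)%g.

Definition dtr (T : finType) (a b c d : T) : {perm T} := (tperm a b * tperm c d)%g.

Lemma tperm_ifE (T : finType) (a b i : T) :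
  tperm a b i = if i == a then b else if i == b then a else i.
Proof. by rewrite permE. Qed.

Ltac eval_eq :=
  repeat (rewrite eqxx || match goal with
    | H : is_true (?x != ?y) |- context [?x == ?y] => rewrite (negPf H)
    | H : is_true (?x != ?y) |- context [?y == ?x] => rewrite (eq_sym y x) (negPf H)
    end); simpl.

Ltac split_uniq :=
  repeat match goal with H : is_true (uniq _) |- _ =>
    move: H; rewrite /= ?inE ?negb_or ?andbT => H end;
  repeat match goal with H : is_true (_ && _) |- _ =>
    let H1 := fresh in let H2 := fresh in case/andP: H => H1 H2 end.

Ltac by_uniq := split_uniq; rewrite /= ?inE ?negb_or ?andbT; eval_eq; by [].

Ltac perm_points :=
  let us := fresh "us" in let i := fresh "i" in
  move=> us; split_uniq;
  apply/permP => i; rewrite /cyc3 /dtr ?permM ?perm1 !tperm_ifE;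
  repeat (match goal with
    | |- context [i == ?x] =>
        let H := fresh in have [H|H] := eqVneq i x; [rewrite ?H {H}|]
    end; eval_eq); by [].

Section Cycles.
Variable T : finType.
Implicit Types a b c d e i : T.
Local Open Scope group_scope.

Lemma dtr_swapr a b c d : dtr a b d c = dtr a b c d.
Proof. by rewrite /dtr (tpermC c). Qed.

Lemma dtr_swapl a b c d : dtr b a c d = dtr a b c d.
Proof. by rewrite /dtr (tpermC a). Qed.

Lemma cyc3_rot a b c : uniq [:: a; b; c] -> cyc3 a b c = cyc3 b c a.
Proof. perm_points. Qed.

Lemma dtrC a b c d : uniq [:: a; b; c; d] -> dtr a b c d = dtr c d a b.
Proof. perm_points. Qed.

(** Together with [cyc3 a b c] these products form its coset of the Klein group in the alternating
    group; they serve to expand [A4_defect]. *)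
Lemma dtr_cyc3 a b c d : uniq [:: a; b; c; d] ->
  [/\ dtr a b c d * cyc3 a b c = cyc3 a c d,
      dtr a c b d * cyc3 a b c = cyc3 b d c &
      dtr a d b c * cyc3 a b c = cyc3 a d b].
Proof. by move=> us; split; move: us; perm_points. Qed.

Lemma dtr_cyc3V a b c d : uniq [:: a; b; c; d] ->
  [/\ dtr a b c d * cyc3 a c b = cyc3 b c d,
      dtr a c b d * cyc3 a c b = cyc3 a b d &
      dtr a d b c * cyc3 a c b = cyc3 a d c].
Proof. by move=> us; split; move: us; perm_points. Qed.

Lemma dtr_dtr a b c d : uniq [:: a; b; c; d] -> dtr a b c d * dtr a c b d = dtr a d b c.
Proof. perm_points. Qed.

(* With V the Klein group of {a, b, c, d}, the double cosets V x V of the three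
   nontrivial x in the Klein group of {a, b, c, q} are obtained from one another
   by right multiplication by powers of cyc3 a b c. *)
Lemma dtr_key a b c d q : uniq [:: a; b; c; d; q] ->
  dtr a c b d * dtr a b c q * dtr a d b c = dtr b c a q * cyc3 a b c.
Proof. perm_points. Qed.

Lemma dtr_keyV a b c d q : uniq [:: a; b; c; d; q] ->
  dtr a b c d * dtr a c b q * dtr a d b c = dtr b c a q * cyc3 a c b.
Proof. perm_points. Qed.

Lemma cyc3_sqr a b c : uniq [:: a; b; c] -> cyc3 a b c * cyc3 a b c = cyc3 a c b.
Proof. perm_points. Qed.

Lemma cyc3_inv a b c : uniq [:: a; b; c] -> cyc3 a b c * cyc3 a c b = 1.
Proof. by rewrite -[cyc3 _ _ _ * _]mulg1; perm_points. Qed.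

(** The three-cycle normalises the Klein group and permutes its three double transpositions
    cyclically. *)
Lemma dtr_cyc3J a b c d : uniq [:: a; b; c; d] ->
  dtr a b c d * cyc3 a b c = cyc3 a b c * dtr a d b c.
Proof. perm_points. Qed.

Lemma dtr_cyc3J2 a b c d : uniq [:: a; b; c; d] ->
  dtr a c b d * cyc3 a b c = cyc3 a b c * dtr a b c d.
Proof. perm_points. Qed.

Lemma dtr_cyc3J3 a b c d : uniq [:: a; b; c; d] ->
  dtr a d b c * cyc3 a b c = cyc3 a b c * dtr a c b d.
Proof. perm_points. Qed.

Lemma dtr_sqr a b c d : uniq [:: a; b; c; d] -> dtr a b c d * dtr a b c d = 1.
Proof. rewrite -[dtr _ _ _ _ * _]mulg1; perm_points. Qed.

End Cycles.

(** * Quadratic forms and positivity of matrices *)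

Section QuadraticForm.
Local Open Scope sesquilinear_scope.
Variables (C : numClosedFieldType) (d : nat).
Implicit Types (M N : 'M[C]_d) (v : 'cV[C]_d).

Definition qform v M : C := (v^t* *m M *m v) 0 0.

(** Hermitian symmetry is kept apart: the theorem derives it from self-adjointness in the group
    algebra. *)
Definition psd M := forall v, 0 <= qform v M.

Lemma qformD v M N : qform v (M + N) = qform v M + qform v N.
Proof. by rewrite /qform mulmxDr mulmxDl mxE. Qed.

Lemma qformZ v a M : qform v (a *: M) = a * qform v M.
Proof. by rewrite /qform -scalemxAr -scalemxAl mxE. Qed.

Lemma qformN v M : qform v (- M) = - qform v M.
Proof. by rewrite -scaleN1r qformZ mulN1r. Qed.

Lemma qformB v M N : qform v (M - N) = qform v M - qform v N.
Proof. by rewrite qformD qformN. Qed.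

Lemma qformMn v M k : qform v (M *+ k) = qform v M *+ k.
Proof. by rewrite -scaler_nat qformZ mulr_natl. Qed.

Lemma qform0 v : qform v 0 = 0.
Proof. by rewrite -(scale0r 0) qformZ mul0r. Qed.

Lemma qform_sum v I (r : seq I) (P : pred I) F :
  qform v (\sum_(i <- r | P i) F i) = \sum_(i <- r | P i) qform v (F i).
Proof. exact: (big_morph _ (qformD v) (qform0 v)). Qed.

Lemma adjmxM m n p (M : 'M[C]_(m, n)) (N : 'M[C]_(n, p)) :
  (M *m N)^t* = N^t* *m M^t*.
Proof. by rewrite trmx_mul map_mxM. Qed.

Lemma adjmxD m n (M N : 'M[C]_(m, n)) : (M + N)^t* = M^t* + N^t*.
Proof. by rewrite linearD /= map_mxD. Qed.

Lemma adjmxB m n (M N : 'M[C]_(m, n)) : (M - N)^t* = M^t* - N^t*.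
Proof. by rewrite linearB /= map_mxB. Qed.

Lemma adjmx1 : (1 : 'M[C]_d)^t* = 1.
Proof. by rewrite trmx1 map_mx1. Qed.

Lemma adjmxMn M k : (M *+ k)^t* = M^t* *+ k.
Proof. by rewrite linearMn /= raddfMn. Qed.

Lemma adjmxZ m n a (M : 'M[C]_(m, n)) : (a *: M)^t* = a^* *: M^t*.
Proof. by rewrite linearZ /= map_mxZ. Qed.

Lemma adjmx_sum m n I (r : seq I) (P : pred I) (F : I -> 'M[C]_(m, n)) :
  (\sum_(i <- r | P i) F i)^t* = \sum_(i <- r | P i) (F i)^t*.
Proof. by rewrite linear_sum /= map_mx_sum. Qed.

Lemma qform_conj v M N : qform v (M^t* * N * M) = qform (M *m v) N.
Proof. by rewrite /qform adjmxM -!mulmxE !mulmxA. Qed.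

Lemma psd_sqr M : psd (M^t* * M).
Proof.
move=> v; rewrite -[M in _ * M]mul1r mulrA qform_conj /qform mulmx1 mxE.
by apply: sumr_ge0 => i _; rewrite !mxE mulrC mul_conjC_ge0.
Qed.

Lemma psd_add M N : psd M -> psd N -> psd (M + N).
Proof. by move=> M0 N0 v; rewrite qformD addr_ge0. Qed.

Lemma psd_scale_gt0 a M : 0 < a -> psd (a *: M) -> psd M.
Proof. by move=> a0 aM v; have := aM v; rewrite qformZ pmulr_rge0. Qed.

Lemma psdMn_gt0 M k : (0 < k)%N -> psd (M *+ k) -> psd M.
Proof.
by move=> k0; rewrite -scaler_nat; apply: psd_scale_gt0; rewrite ltr0n.
Qed.

Lemma psd_conj M N : psd N -> psd (M^t* * N * M).
Proof. by move=> N0 v; rewrite qform_conj. Qed.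

End QuadraticForm.

(* Products are abstracted first: mxE would unfold them into sums. *)
Ltac mx_linear :=
  repeat match goal with
    | |- context [@GRing.mul ?R ?a ?b] =>
        match type of (@GRing.mul R a b) with context [matrix] => idtac | _ => fail end;
        let x := fresh "x" in set x := @GRing.mul R a b; move: x => x
  end;
  try (let x := fresh "x" in set x := @GRing.one _; move: x => x);
  let i := fresh in let j := fresh in
  apply/matrixP => i j; rewrite !(mulmxnE, mxE); ring.

(** * Ring identities for three-cycles and double cosets *)

Section RingIdentities.
Variables (C : numClosedFieldType) (d : nat).
Implicit Types p m r v x k s : 'M[C]_d.

(** Since r cubes to 1 with inverse r', the element 2 - r - r' is three times the complement of the
    averaging idempotent (1 + r + r') / 3. *)
Lemma three_cycle_sqr r r' : r * r = r' -> r' * r' = r -> r * r' = 1 ->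
  r' * r = 1 -> (1 *+ 2 - r - r') * (1 *+ 2 - r - r') = (1 *+ 2 - r - r') *+ 3.
Proof.
move=> rr rr' rr1 rr2.
rewrite !(mulrBl, mulrBr, mulrnAr, mulrnAl) rr rr' rr1 rr2 !mulr1 !mul1r.
by mx_linear.
Qed.

(* By key1 and key2 the three products p x_i p differ by powers of r, so their
   sum is a multiple of 1 + r + r', which m annihilates. *)
Lemma double_coset_key p r r' x1 x2 x3 u1 u2 u3 : r * r = r' -> r' * r' = r ->
  r * r' = 1 -> r' * r = 1 -> p * r = r * p -> p * r' = r' * p ->
  p = 1 + u1 + u2 + u3 -> (forall u, u \in [:: u1; u2; u3] -> p * u = p /\ u * p = p) ->
  u2 * x1 * u3 = x3 * r -> u1 * x2 * u3 = x3 * r' ->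
  let m := 1 *+ 2 - r - r' in
  p * (1 + x1 + x2 + x3) * (p * m * m) = (p * m) *+ 12.
Proof.
move=> rr rr' rr1 rr2 pr pr' def_p pu key1 key2 m.
have pp : p * p = p *+ 4.
  have [[p1 _] [p2 _] [p3 _]] : [/\ p * u1 = p /\ u1 * p = p,
     p * u2 = p /\ u2 * p = p & p * u3 = p /\ u3 * p = p].
    by split; apply: pu; rewrite !inE eqxx ?orbT.
  by rewrite {2}def_p !mulrDr mulr1 p1 p2 p3; mx_linear.
have [p1 up1] : p * u1 = p /\ u1 * p = p by apply: pu; rewrite !inE eqxx.
have [p2 up2] : p * u2 = p /\ u2 * p = p by apply: pu; rewrite !inE eqxx ?orbT.
have [p3 up3] : p * u3 = p /\ u3 * p = p by apply: pu; rewrite !inE eqxx ?orbT.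
(* As p absorbs [u2] on its right and [u3] on its left, [x1] may be replaced by [u2 * x1 * u3]. *)
have e1 : p * x1 * p = p * x3 * p * r.
  by rewrite -!mulrA pr (mulrA x3) -key1 -!mulrA up3 !mulrA p2.
have e2 : p * x2 * p = p * x3 * p * r'.
  by rewrite -!mulrA pr' (mulrA x3) -key2 -!mulrA up3 !mulrA p1.
have sm0 : (1 + r + r') * m = 0.
  rewrite /m !(mulrBr, mulrDl, mulrnAr) !mulr1 !mul1r rr rr1 rr2 rr'.
  by mx_linear.
have mm : m * m = m *+ 3 by apply: three_cycle_sqr.
clearbody m.
have -> : p * (1 + x1 + x2 + x3) * (p * m * m)
  = p * p * m * m + p * x3 * p * ((1 + r + r') * m) * m.
  rewrite !(mulrDr p) mulr1 !mulrA !mulrDl e1 e2 !mulrDr !mulr1 !mulrDl.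
  by mx_linear.
rewrite sm0 mulr0 mul0r addr0 pp -mulrA mm mulrnAl mulrnAr -mulrnA //.
Qed.

End RingIdentities.

(** * Iterated weighted sums *)

Section WeightedSum.
Variables (C : numClosedFieldType) (T : finType).
Implicit Types (b : T -> C) (F : T -> C).

Definition wsum b F := \sum_x b x * F x.

Lemma eq_wsum b F G : F =1 G -> wsum b F = wsum b G.
Proof. by move=> FG; apply: eq_bigr => x _; rewrite FG. Qed.

Lemma wsumD b F G : wsum b (fun x => F x + G x) = wsum b F + wsum b G.
Proof. by rewrite -big_split; apply: eq_bigr => x _; rewrite mulrDr. Qed.

Lemma wsumZ b a F : wsum b (fun x => a * F x) = a * wsum b F.
Proof. by rewrite mulr_sumr; apply: eq_bigr => x _; rewrite mulrCA. Qed.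

Lemma wsumB b F G : wsum b (fun x => F x - G x) = wsum b F - wsum b G.
Proof. by rewrite -sumrB; apply: eq_bigr => x _; rewrite mulrBr. Qed.

Lemma wsumC b (f : T -> T -> C) :
  wsum b (fun x => wsum b (f x)) = wsum b (fun y => wsum b (f^~ y)).
Proof.
rewrite /wsum; under eq_bigr do rewrite mulr_sumr.
rewrite exchange_big; apply: eq_bigr => x _; rewrite mulr_sumr.
by apply: eq_bigr => y _; rewrite mulrCA.
Qed.

Lemma wsum_ge0 b F : (forall x, 0 <= b x) -> (forall x, 0 <= F x) -> 0 <= wsum b F.
Proof. by move=> b0 F0; apply: sumr_ge0 => x _; rewrite mulr_ge0. Qed.

Lemma wsum_const b a : wsum b (fun=> a) = (\sum_x b x) * a.
Proof. by rewrite mulr_suml. Qed.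

(** All quadruples are included, also those with coinciding points, so that the variables can be
    permuted and summed out freely. *)
Definition wsum4 b (f : T -> T -> T -> T -> C) :=
  wsum b (fun x => wsum b (fun y => wsum b (fun z => wsum b (f x y z)))).

Lemma eq_wsum4 b f g : (forall x y z w, f x y z w = g x y z w) ->
  wsum4 b f = wsum4 b g.
Proof. by move=> fg; do 4![apply: eq_wsum => ?]. Qed.

Lemma wsum4D b f g :
  wsum4 b (fun x y z w => f x y z w + g x y z w) = wsum4 b f + wsum4 b g.
Proof.
rewrite -wsumD; apply: eq_wsum => x; rewrite -wsumD; apply: eq_wsum => y.
by rewrite -wsumD; apply: eq_wsum => z; rewrite -wsumD.
Qed.

Lemma wsum4Z b a f : wsum4 b (fun x y z w => a * f x y z w) = a * wsum4 b f.
Proof.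
rewrite -wsumZ; apply: eq_wsum => x; rewrite -wsumZ; apply: eq_wsum => y.
by rewrite -wsumZ; apply: eq_wsum => z; rewrite -wsumZ.
Qed.

Lemma wsum4_swap12 b f : wsum4 b (fun x y => f y x) = wsum4 b f.
Proof. by rewrite /wsum4 wsumC. Qed.

Lemma wsum4_swap23 b f : wsum4 b (fun x y z => f x z y) = wsum4 b f.
Proof. by apply: eq_wsum => x; rewrite wsumC. Qed.

Lemma wsum4_swap34 b f : wsum4 b (fun x y z w => f x y w z) = wsum4 b f.
Proof. by do 2![apply: eq_wsum => ?]; rewrite wsumC. Qed.

Lemma wsum4_indep b (f : T -> T -> T -> C) : \sum_x b x = 0 ->
  wsum4 b (fun x y z _ => f x y z) = 0.
Proof.
move=> b0; rewrite -[RHS](mul0r (wsum4 b (fun x y z _ => f x y z))) -wsum4Z.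
do 3![apply: eq_wsum => ?].
by rewrite wsum_const b0 mul0r wsum_const b0 mul0r.
Qed.

(* A point charge at q neutralising the weights c turns summation into
   summation of differences. *)
Lemma wsum_neutral (c : T -> C) q F :
  wsum (fun x => c x - (x == q)%:R * \sum_y c y) F = wsum c (fun x => F x - F q).
Proof.
rewrite /wsum; under eq_bigr do rewrite mulrBl.
under [RHS]eq_bigr do rewrite mulrBr.
rewrite !sumrB; congr (_ - _); rewrite -[RHS]mulr_suml (bigD1 q) //= eqxx mul1r.
by rewrite [X in _ + X]big1 ?addr0 // => x /negPf->; rewrite !mul0r.
Qed.

End WeightedSum.

(** * The five-point inequality *)

Section UnitaryRepresentation.
Local Open Scope sesquilinear_scope.
Variables (C : numClosedFieldType) (T : finType) (d : nat).
Variable rho : mx_representation C [set: {perm T}] d.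
Hypothesis rhoU : forall s, rho s \is unitarymx.
Implicit Types (a b c e q x y z w : T) (s : {perm T}).

Lemma rhoM s1 s2 : rho (s1 * s2)%g = rho s1 * rho s2.
Proof. by rewrite repr_mxM ?inE. Qed.

Lemma rho1 : rho 1%g = 1.
Proof. exact: repr_mx1. Qed.

Lemma rho_adj s : (rho s)^t* = rho s^-1%g.
Proof. by rewrite repr_mxV ?inE // invmx_unitary. Qed.

Definition V4_sum a b c e :=
  1 + rho (dtr a b c e) + rho (dtr a c b e) + rho (dtr a e b c).

(** For distinct points, three times the projection orthogonal to the vectors fixed by
    [cyc3 a b c]. *)
Definition C3_defect a b c := 1 *+ 2 - rho (cyc3 a b c) - rho (cyc3 a c b).

(* 12 times the projection onto the vectors fixed by the Klein group of
   {a, b, c, e} and orthogonal to those fixed by its alternating group. *)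
Definition A4_defect a b c e := V4_sum a b c e * C3_defect a b c.

Lemma tpermV_adj x y : (rho (tperm x y))^t* = rho (tperm x y).
Proof. by rewrite rho_adj tpermV. Qed.

(** Multiplication by a Klein group element permutes the summands; [e11] to [e32] are the
    multiplication table. *)
Lemma V4_sum_fix a b c e v : uniq [:: a; b; c; e] ->
  v \in [:: rho (dtr a b c e); rho (dtr a c b e); rho (dtr a e b c)] ->
  V4_sum a b c e * v = V4_sum a b c e /\ v * V4_sum a b c e = V4_sum a b c e.
Proof.
move=> us.
have e11 := dtr_sqr us.
have e22 : (dtr a c b e * dtr a c b e)%g = 1%g by apply: dtr_sqr; by_uniq.
have e33 : (dtr a e b c * dtr a e b c)%g = 1%g by apply: dtr_sqr; by_uniq.
have e12 := dtr_dtr us.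
have e21 : (dtr a c b e * dtr a b c e)%g = dtr a e b c.
  by rewrite dtr_dtr; last (by by_uniq); first [done|exact: dtr_swapr].
have e13 : (dtr a b c e * dtr a e b c)%g = dtr a c b e.
  by rewrite -(dtr_swapr _ _ c) dtr_dtr; last (by by_uniq); first [done|exact: dtr_swapr].
have e31 : (dtr a e b c * dtr a b c e)%g = dtr a c b e.
  by rewrite -(dtr_swapr _ _ c e) dtr_dtr; last (by by_uniq); first [done|exact: dtr_swapr].
have e23 : (dtr a c b e * dtr a e b c)%g = dtr a b c e.
  rewrite -(dtr_swapr _ _ b e) -(dtr_swapr _ _ b c) dtr_dtr; last by by_uniq.
  by first [done|exact: dtr_swapr].
have e32 : (dtr a e b c * dtr a c b e)%g = dtr a b c e.
  rewrite -(dtr_swapr _ _ b e) -(dtr_swapr _ _ b c) dtr_dtr; last by by_uniq.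
  by first [done|exact: dtr_swapr].
by rewrite !inE => /or3P[] /eqP->; split;
  rewrite /V4_sum !(mulrDl, mulrDr) -!rhoM ?(e11, e22, e33, e12, e21, e13, e31, e23, e32)
    rho1 ?mulr1 ?mul1r; mx_linear.
Qed.

Lemma V4_sumC a b c e : uniq [:: a; b; c; e] ->
  V4_sum a b c e * rho (cyc3 a b c) = rho (cyc3 a b c) * V4_sum a b c e.
Proof.
move=> us; rewrite /V4_sum !(mulrDl, mulrDr) -!rhoM dtr_cyc3J //.
by rewrite dtr_cyc3J2 // dtr_cyc3J3 // mul1r mulr1; mx_linear.
Qed.

Lemma dtr_inv a b c e : uniq [:: a; b; c; e] -> (dtr a b c e)^-1%g = dtr a b c e.
Proof. by move=> us; apply/eqP; rewrite eq_invg_mul dtr_sqr. Qed.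

Lemma cyc3_invg a b c : uniq [:: a; b; c] -> (cyc3 a b c)^-1%g = cyc3 a c b.
Proof. by move=> us; apply/eqP; rewrite eq_invg_mul cyc3_inv. Qed.

Lemma V4_sum_adj a b c e : uniq [:: a; b; c; e] ->
  (V4_sum a b c e)^t* = V4_sum a b c e.
Proof.
move=> us; rewrite !adjmxD adjmx1 !rho_adj !dtr_inv //; by_uniq.
Qed.

Lemma C3_defect_adj a b c : uniq [:: a; b; c] ->
  (C3_defect a b c)^t* = C3_defect a b c.
Proof.
move=> us; rewrite !adjmxB adjmxMn adjmx1 !rho_adj !cyc3_invg //; last by_uniq.
by rewrite addrAC.
Qed.

Lemma V4_sumCV a b c e : uniq [:: a; b; c; e] ->
  V4_sum a b c e * rho (cyc3 a c b) = rho (cyc3 a c b) * V4_sum a b c e.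
Proof.
move=> us; rewrite -cyc3_sqr; last by_uniq.
by rewrite rhoM mulrA V4_sumC // -mulrA V4_sumC // mulrA.
Qed.

Lemma A4_defectC a b c e : uniq [:: a; b; c; e] ->
  C3_defect a b c * V4_sum a b c e = A4_defect a b c e.
Proof.
move=> us; rewrite /A4_defect /C3_defect !(mulrBl, mulrBr).
by rewrite V4_sumC // V4_sumCV // mulrnAl mulrnAr mulr1 mul1r.
Qed.

Lemma A4_defect_adj a b c e : uniq [:: a; b; c; e] ->
  (A4_defect a b c e)^t* = A4_defect a b c e.
Proof.
move=> us; rewrite -[RHS](A4_defectC us) [LHS]adjmxM (V4_sum_adj us).
by rewrite C3_defect_adj; by_uniq.
Qed.

Lemma V4_sum_sqr a b c e : uniq [:: a; b; c; e] ->
  V4_sum a b c e * V4_sum a b c e = V4_sum a b c e *+ 4.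
Proof.
move=> us; rewrite {2}/V4_sum !mulrDr mulr1.
rewrite !(fun v h => (@V4_sum_fix a b c e v us h).1) ?inE ?eqxx ?orbT //.
by mx_linear.
Qed.

Lemma C3_defect_sqr a b c : uniq [:: a; b; c] ->
  C3_defect a b c * C3_defect a b c = C3_defect a b c *+ 3.
Proof.
move=> us; have us' : uniq [:: a; c; b] by by_uniq.
by rewrite three_cycle_sqr // -rhoM ?cyc3_sqr ?cyc3_inv ?rho1.
Qed.

Lemma A4_defect_sqr a b c e : uniq [:: a; b; c; e] ->
  A4_defect a b c e * A4_defect a b c e = A4_defect a b c e *+ 12.
Proof.
move=> us; have us3 : uniq [:: a; b; c] by by_uniq.
rewrite -{1}(A4_defectC us) /A4_defect mulrA -(mulrA (C3_defect _ _ _)) (V4_sum_sqr us).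
rewrite mulrnAr (A4_defectC us) /A4_defect mulrnAl -mulrA (C3_defect_sqr us3).
by rewrite mulrnAr -mulrnA.
Qed.

(** Being self-adjoint with square 12 times itself, the operator is a positive multiple of
    [M^t* * M]. *)
Lemma A4_defect_psd a b c e : uniq [:: a; b; c; e] -> psd (A4_defect a b c e).
Proof.
move=> us; apply: (@psdMn_gt0 _ _ _ 12) => //.
by rewrite -A4_defect_sqr // -{1}A4_defect_adj //; apply: psd_sqr.
Qed.

Lemma A4_defectJ s a b c e :
  rho s^-1%g * A4_defect a b c e * rho s = A4_defect (s a) (s b) (s c) (s e).
Proof.
have ss : rho s * rho s^-1%g = 1 by rewrite -rhoM mulgV rho1.
have ss' : rho s^-1%g * rho s = 1 by rewrite -rhoM mulVg rho1.
have J u : rho (u ^ s)%g = rho s^-1%g * rho u * rho s.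
  by rewrite -!rhoM conjgE mulgA.
have JM M N : rho s^-1%g * (M * N) * rho s =
    (rho s^-1%g * M * rho s) * (rho s^-1%g * N * rho s).
  by rewrite !mulrA -(mulrA (rho s^-1%g * M) (rho s)) ss mulr1.
rewrite /A4_defect JM; congr (_ * _).
  rewrite /V4_sum !(mulrDr, mulrDl) mulr1 ss' -!J /dtr !conjMg !tpermJ //.
rewrite /C3_defect !(mulrBr, mulrBl) mulrnAr mulrnAl mulr1 ss' -!J.
by rewrite /cyc3 !conjMg !tpermJ.
Qed.

Lemma A4_defect_fix a b c e s : uniq [:: a; b; c; e] ->
  s \in [:: dtr a b c e; dtr a c b e; dtr a e b c] ->
  rho s * A4_defect a b c e = A4_defect a b c e /\
  A4_defect a b c e * rho s = A4_defect a b c e.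
Proof.
move=> us sV; have sV' : rho s \in
    [:: rho (dtr a b c e); rho (dtr a c b e); rho (dtr a e b c)].
  by move: sV; rewrite !inE => /or3P[] /eqP->; rewrite eqxx ?orbT.
split; first by rewrite /A4_defect mulrA (V4_sum_fix us sV').2.
by rewrite -A4_defectC // -mulrA (V4_sum_fix us sV').1.
Qed.

(** Relabelling the points is conjugation, and Klein group elements are absorbed on both sides. This
    allows reordering the arguments. *)
Lemma A4_defectJV a b c e s : uniq [:: a; b; c; e] ->
  s \in [:: dtr a b c e; dtr a c b e; dtr a e b c] ->
  A4_defect (s a) (s b) (s c) (s e) = A4_defect a b c e.
Proof.
move=> us sV; rewrite -A4_defectJ.
have sVi : s^-1%g \in [:: dtr a b c e; dtr a c b e; dtr a e b c].
  by move: sV; rewrite !inE => /or3P[] /eqP->;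
    rewrite dtr_inv ?eqxx ?orbT //; by_uniq.
by rewrite (A4_defect_fix us sVi).1 (A4_defect_fix us sV).2.
Qed.

(* With S the sum of the four terms and K the last one: S is the sum of the
   conjugates of A4_defect a b c q under the Klein group of {a, b, c, e}, which
   yields S K = 12 K, hence (12 - K) S (12 - K) = 144 (S - K). *)
Lemma A4_defect_five a b c e q : uniq [:: a; b; c; e; q] ->
  psd (A4_defect q b c e + A4_defect a q c e + A4_defect a b q e
       + A4_defect a b c q - A4_defect a b c e).
Proof.
move=> us; have us4 : uniq [:: a; b; c; e] by by_uniq.
have us1 : uniq [:: a; b; c; q] by by_uniq.
have us3 : uniq [:: a; b; c] by by_uniq.
have us3' : uniq [:: a; c; b] by by_uniq.
set S := _ + A4_defect a b c q; set K := A4_defect a b c e.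
pose K' := A4_defect a b c q.
have defS : S = K' + rho (dtr a b c e) * K' * rho (dtr a b c e)
     + rho (dtr a c b e) * K' * rho (dtr a c b e)
     + rho (dtr a e b c) * K' * rho (dtr a e b c).
  have conjK' x y z w : uniq [:: x; y; z; w] ->
    rho (dtr x y z w) * K' * rho (dtr x y z w) =
    A4_defect (dtr x y z w a) (dtr x y z w b) (dtr x y z w c) (dtr x y z w q).
    by move=> uxyz; rewrite -A4_defectJ dtr_inv.
  (* A Klein relabelling moves q to the last slot, where the term is visibly a conjugate of [K']. *)
  have e1 : A4_defect a b q e = A4_defect b a e q.
    rewrite -[RHS](@A4_defectJV _ _ _ _ (dtr b a e q)) ?inE ?eqxx //; last by by_uniq.
    by rewrite /dtr !permM !tperm_ifE; split_uniq; eval_eq.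
  have e2 : A4_defect a q c e = A4_defect c e a q.
    rewrite -[RHS](@A4_defectJV _ _ _ _ (dtr c a e q)) ?inE ?eqxx ?orbT //; last by by_uniq.
    by rewrite /dtr !permM !tperm_ifE; split_uniq; eval_eq.
  have e3 : A4_defect q b c e = A4_defect e c b q.
    rewrite -[RHS](@A4_defectJV _ _ _ _ (dtr e q c b)) ?inE ?eqxx ?orbT //; last by by_uniq.
    by rewrite /dtr !permM !tperm_ifE; split_uniq; eval_eq.
  have c1 : rho (dtr a b c e) * K' * rho (dtr a b c e) = A4_defect a b q e.
    rewrite e1 conjK' //.
    by rewrite /dtr !permM !tperm_ifE; split_uniq; eval_eq.
  have c2 : rho (dtr a c b e) * K' * rho (dtr a c b e) = A4_defect a q c e.
    rewrite e2 conjK'; last by by_uniq.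
    by rewrite /dtr !permM !tperm_ifE; split_uniq; eval_eq.
  have c3 : rho (dtr a e b c) * K' * rho (dtr a e b c) = A4_defect q b c e.
    rewrite e3 conjK'; last by by_uniq.
    by rewrite /dtr !permM !tperm_ifE; split_uniq; eval_eq.
  by rewrite c1 c2 c3 /S -/K'; mx_linear.
have fixK v : v \in [:: dtr a b c e; dtr a c b e; dtr a e b c] -> rho v * K = K.
  by move=> hv; rewrite (A4_defect_fix us4 hv).1.
have SK : S * K = K *+ 12.
  rewrite defS !mulrDl -!(mulrA _ (rho _) K) !fixK ?inE ?eqxx ?orbT //.
  have -> : K' * K + rho (dtr a b c e) * K' * K + rho (dtr a c b e) * K' * K
      + rho (dtr a e b c) * K' * K = V4_sum a b c e * K' * K.
    by rewrite /V4_sum !mulrDl mul1r.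
  have defV' : V4_sum a b c q =
      1 + rho (dtr a b c q) + rho (dtr a c b q) + rho (dtr b c a q).
    by rewrite /V4_sum (@dtrC _ b c) //; by_uniq.
  (* [K'] and [K] share the factor [C3_defect a b c]; commuting it past [V4_sum a b c e] gives the
     shape of [double_coset_key]. *)
  have -> : V4_sum a b c e * K' * K = V4_sum a b c e * V4_sum a b c q
      * (V4_sum a b c e * C3_defect a b c * C3_defect a b c).
    rewrite -[V4_sum a b c e * C3_defect a b c]/(A4_defect a b c e).
    by rewrite -A4_defectC // /K' /K /A4_defect !mulrA.
  rewrite defV'.
  apply: (@double_coset_key _ _ _ (rho (cyc3 a b c)) (rho (cyc3 a c b)) _ _ _
    (rho (dtr a b c e)) (rho (dtr a c b e)) (rho (dtr a e b c)));
    rewrite -?rhoM ?cyc3_sqr ?cyc3_inv ?rho1 ?dtr_key ?dtr_keyV ?V4_sumC ?V4_sumCV //.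
  by move=> u; apply: V4_sum_fix.
have K_adj : K^t* = K by apply: A4_defect_adj.
have S_adj : S^t* = S.
  by rewrite /S !adjmxD !A4_defect_adj //; by_uniq.
have KS : K * S = K *+ 12.
  by rewrite -{1}K_adj -{1}S_adj -!mulmxE -adjmxM mulmxE SK adjmxMn K_adj.
have S0 : psd S.
  rewrite /S; apply: psd_add; first (apply: psd_add; first apply: psd_add);
    apply: A4_defect_psd; by_uniq.
have KK : K * K = K *+ 12 by apply: A4_defect_sqr.
clearbody K; move: K S S0 S_adj K_adj SK KS KK {defS fixK} => K S S0 S_adj K_adj SK KS KK.
apply: (@psdMn_gt0 _ _ _ (12 * 12)) => //.
have -> : (S - K) *+ (12 * 12) = (1 *+ 12 - K)^t* * S * (1 *+ 12 - K).
  rewrite adjmxB adjmxMn adjmx1 K_adj.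
  rewrite !(mulrBl, mulrBr, mulrnAl, mulrnAr, mul1r, mulr1) KS !(mulrnAl, SK, KK) !mulrnA.
  by mx_linear.
exact: psd_conj.
Qed.

End UnitaryRepresentation.

(** * The octopus inequality *)

Ltac by_neq := rewrite /= ?inE;
  repeat match goal with H : is_true (?a != ?b) |- _ =>
    rewrite ?(eq_sym b a) ?(negPf H); move: H end; by intros.

Section Octopus.
Local Open Scope sesquilinear_scope.
Variables (C : numClosedFieldType) (T : finType) (d : nat).
Variable rho : mx_representation C [set: {perm T}] d.
Hypothesis rhoU : forall s, rho s \is unitarymx.
Variable v : 'cV[C]_d.
Implicit Types (a b c e q x y z w : T) (s : {perm T}).

Let h s := qform v (rho s).

(* The degenerate values make four_point_identity hold on coinciding points. *)
Definition three_point_form x y z : C :=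
  if uniq [:: x; y; z] then h 1%g / 2 - h (cyc3 x y z) - h (cyc3 x z y)
  else if (x == y) && (y == z) then h 1%g * (3 / 2) else - (h 1%g / 2).

(** Its fourfold sum with weights b is the form of 2 N W - W^2, where W is
    [weighted_transpositions b] and N the sum of the [b x ^+ 2]. *)
Definition pairing_form x y z w : C :=
  (z == w)%:R * h (tperm x y) *+ 2 - h (dtr x y z w).

Definition A4_form x y z w : C :=
  if uniq [:: x; y; z; w] then qform v (A4_defect rho x y z w) else 0.

(** [A4_defect] is three times the sum over the Klein group minus the sum over the alternating
    group, hence the coefficients 2 and -1. *)
Lemma qform_A4_defect x y z w : uniq [:: x; y; z; w] ->
  qform v (A4_defect rho x y z w) = h 1%g *+ 2
   + (h (dtr x y z w) + h (dtr x z y w) + h (dtr x w y z)) *+ 2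
   - (h (cyc3 x y z) + h (cyc3 x z y) + h (cyc3 x z w) + h (cyc3 x w z)
      + h (cyc3 y z w) + h (cyc3 y w z) + h (cyc3 x y w) + h (cyc3 x w y)).
Proof.
move=> us; have [e1 e2 e3] := dtr_cyc3 us; have [f1 f2 f3] := dtr_cyc3V us.
rewrite /A4_defect /C3_defect !(mulrBr, mulrnAr) mulr1 /V4_sum !mulrDl !mul1r.
rewrite -!rhoM e1 e2 e3 f1 f2 f3 !(qformB, qformD) -(rho1 rho) -!/(h _).
by ring.
Qed.

(** For distinct points the double transpositions cancel, each three-cycle belongs to one of the
    four triples, and 2 [h 1] is shared equally among the triples. Coincidences are checked case by
    case. *)
Lemma four_point_identity x y z w :
  pairing_form x y z w + pairing_form z w x y + pairing_form x z y w
  + pairing_form y w x z + pairing_form x w y z + pairing_form y z x w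
  + A4_form x y z w =
  three_point_form x y z + three_point_form x y w + three_point_form x z w
  + three_point_form y z w.
Proof.
have d1 a b c : dtr a a b c = tperm b c by rewrite /dtr tperm1 mul1g.
have d2 a b c : dtr b c a a = tperm b c by rewrite /dtr tperm1 mulg1.
have d3 a b : dtr a b a b = 1%g by apply: tperm2.
have d4 a b : dtr a b b a = 1%g by rewrite dtr_swapr d3.
have d5 a b c : dtr a b a c = cyc3 a b c by [].
have d6 a b c : dtr a b c a = cyc3 a b c by rewrite dtr_swapr.
have d7 a b c : dtr b a a c = cyc3 a b c by rewrite dtr_swapl.
have d8 a b c : dtr b a c a = cyc3 a b c by rewrite dtr_swapl dtr_swapr.
have dd := (d1, d2, d3, d4, tperm1, (d5, d6, d7, d8)).
rewrite /A4_form /pairing_form /three_point_form.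
have [yx|xy] := eqVneq y x; [subst y|]; (have [zx|xz] := eqVneq z x; [subst z|]);
  (have [wx|xw] := eqVneq w x; [subst w|]).
all: try (have [zy|yz] := eqVneq z y; [subst z|]).
all: try (have [wy|yw] := eqVneq w y; [subst w|]).
all: try (have [wz|zw] := eqVneq w z; [subst w|]).
all: rewrite ?eqxx /= ?inE.
all: repeat match goal with H : is_true (?a != ?b) |- _ =>
  rewrite ?(eq_sym b a) ?(negPf H); move: H end; intros.
all: rewrite ?eqxx /=.
all: rewrite ?dd.
(* Equal three-cycles are identified by rotating them to start at x, equal transpositions by
   ordering their points. *)
all: rewrite -?(@cyc3_rot _ x); try by_neq.
all: rewrite ?(@cyc3_rot _ _ x); try by_neq.
all: rewrite ?(tpermC y x) ?(tpermC z x) ?(tpermC w x).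
all: rewrite ?(tpermC z y) ?(tpermC w y) ?(tpermC w z).
all: rewrite /= ?mul1r ?mul0r.
all: try ring.
all: try (field; by []).
rewrite qform_A4_defect; last by by_neq.
rewrite (@dtrC _ z w) ?(@dtrC _ y w) ?(@dtrC _ y z); try by by_neq.
by field.
Qed.

(** For five distinct points this is [A4_defect_five]. If q is one of the four points, a term on the
    right equals the left-hand side; if those four are not distinct, the left-hand side is 0. *)
Lemma A4_form_five x y z w q :
  A4_form x y z w <= A4_form q y z w + A4_form x q z w + A4_form x y q w
                     + A4_form x y z q.
Proof.
have pos a b c e : 0 <= A4_form a b c e.
  by rewrite /A4_form; case: ifP => // us; apply: A4_defect_psd.
have [us|nus] := boolP (uniq [:: x; y; z; w; q]).
  rewrite /A4_form !ifT; try by_uniq.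
  by rewrite -subr_ge0 -!qformD -qformB; apply: A4_defect_five.
have [us4|/negPf us4] := boolP (uniq [:: x; y; z; w]); last first.
  by rewrite {1}/A4_form us4 !addr_ge0.
have : q \in [:: x; y; z; w].
  move: nus; rewrite -[[:: x; y; z; w; q]]/(rcons [:: x; y; z; w] q).
  by rewrite rcons_uniq us4 andbT negbK.
rewrite !inE => /or4P[] /eqP->.
- by rewrite -!addrA lerDl !addr_ge0.
- by rewrite -!addrA addrCA lerDl !addr_ge0.
- by rewrite -addrA addrCA lerDl !addr_ge0.
- by rewrite lerDr !addr_ge0.
Qed.

(** The diagonal x = y contributes [b x ^+ 2] times the identity. *)
Definition weighted_transpositions (b : T -> C) : 'M[C]_d :=
  \sum_x \sum_y (b x * b y) *: rho (tperm x y).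

Lemma qform_weighted (b : T -> C) : qform v (weighted_transpositions b) =
  wsum b (fun x => wsum b (fun y => h (tperm x y))).
Proof.
rewrite qform_sum; apply: eq_bigr => x _; rewrite qform_sum mulr_sumr.
by apply: eq_bigr => y _; rewrite qformZ mulrA.
Qed.

Lemma qform_weighted_sqr (b : T -> C) :
  qform v (weighted_transpositions b * weighted_transpositions b) =
  wsum4 b (fun x y z w => h (dtr x y z w)).
Proof.
rewrite mulr_suml qform_sum; apply: eq_bigr => x _.
rewrite mulr_suml qform_sum mulr_sumr; apply: eq_bigr => y _.
rewrite mulr_sumr qform_sum !mulr_sumr; apply: eq_bigr => z _.
rewrite mulr_sumr qform_sum !mulr_sumr; apply: eq_bigr => w _.
by rewrite -mulmxE -scalemxAl -scalemxAr !qformZ mulmxE -rhoM !mulrA.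
Qed.

Lemma weighted_transpositions_adj (b : T -> C) : (forall x, b x \is Num.real) ->
  (weighted_transpositions b)^t* = weighted_transpositions b.
Proof.
move=> bR; rewrite adjmx_sum; apply: eq_bigr => x _; rewrite adjmx_sum.
apply: eq_bigr => y _; rewrite adjmxZ tpermV_adj //.
by rewrite (CrealP _) // rpredM.
Qed.

(** Sum [four_point_identity] over all quadruples: every three-point term leaves one variable free
    and vanishes with the total weight. *)
Lemma wsum4_A4_form (b : T -> C) : \sum_x b x = 0 ->
  (\sum_x b x ^+ 2) * qform v (weighted_transpositions b) *+ 12
  = qform v (weighted_transpositions b * weighted_transpositions b) *+ 6
    - wsum4 b A4_form.
Proof.
move=> b0; rewrite qform_weighted_sqr.
have pairing_sum : wsum4 b pairing_form =
    (\sum_x b x ^+ 2) * qform v (weighted_transpositions b) *+ 2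
    - wsum4 b (fun x y z w => h (dtr x y z w)).
  transitivity (wsum4 b (fun x y z w => 2 * ((z == w)%:R * h (tperm x y))
      + -1 * h (dtr x y z w))).
    by apply: eq_wsum4 => x y z w; rewrite /pairing_form; ring.
  rewrite wsum4D !wsum4Z qform_weighted.
  suff -> : wsum4 b (fun x y z w => (z == w)%:R * h (tperm x y)) =
     (\sum_x b x ^+ 2) * wsum b (fun x => wsum b (fun y => h (tperm x y))) by ring.
  rewrite -wsumZ; apply: eq_wsum => x; rewrite -wsumZ; apply: eq_wsum => y.
  rewrite mulr_suml; apply: eq_bigr => z _.
  rewrite /wsum (bigD1 z) //= eqxx mul1r big1 ?addr0; first by rewrite mulrA.
  by move=> w /negPf; rewrite eq_sym => ->; rewrite mul0r mulr0.
move: pairing_form three_point_form A4_form four_point_identity pairing_sum.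
move=> p f3 f4 id4.
set P := wsum4 b p => pairing_sum.
(* The six pairings differ by a permutation of the summation variables, so each has sum P. *)
have P1 : wsum4 b (fun x y z w => p x z y w) = P by apply: wsum4_swap23.
have P2 : wsum4 b (fun x y z w => p x w y z) = P by rewrite -P1 -wsum4_swap34.
have P3 : wsum4 b (fun x y z w => p y z x w) = P by rewrite -P1 -wsum4_swap12.
have P4 : wsum4 b (fun x y z w => p y w x z) = P by rewrite -P2 -wsum4_swap12.
have P5 : wsum4 b (fun x y z w => p z w x y) = P by rewrite -P4 -wsum4_swap23.
have T1 := wsum4_indep f3 b0.
have T2 : wsum4 b (fun x y z w => f3 x y w) = 0 by rewrite -T1 -wsum4_swap34.
have T3 : wsum4 b (fun x y z w => f3 x z w) = 0 by rewrite -T2 -wsum4_swap23.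
have T4 : wsum4 b (fun x y z w => f3 y z w) = 0 by rewrite -T3 -wsum4_swap12.
have /eqP := eq_wsum4 b id4.
rewrite !wsum4D P1 P2 P3 P4 P5 T1 T2 T3 T4 -/P pairing_sum !addr0 addr_eq0 => /eqP H.
by rewrite -[wsum4 b f4]opprK -H; ring.
Qed.

(** Expanding the charge at q puts q into some of the slots with a sign; terms with q in two slots
    vanish, and what remains is [A4_form_five] summed with nonnegative weights. *)
Lemma wsum4_A4_form_le0 (c : T -> C) q : (forall x, 0 <= c x) ->
  wsum4 (fun x => c x - (x == q)%:R * \sum_y c y) A4_form <= 0.
Proof.
move=> c0; set b := fun x => _.
have A40 x y z w : ~~ uniq [:: x; y; z; w] -> A4_form x y z w = 0.
  by rewrite /A4_form => /negPf->.
have z12 a e : A4_form q q a e = 0 by apply: A40; rewrite /= !inE eqxx ?orbT ?andbF.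
have z13 a e : A4_form q a q e = 0 by apply: A40; rewrite /= !inE eqxx ?orbT ?andbF.
have z14 a e : A4_form q a e q = 0 by apply: A40; rewrite /= !inE eqxx ?orbT ?andbF.
have z23 a e : A4_form a q q e = 0 by apply: A40; rewrite /= !inE eqxx ?orbT ?andbF.
have z24 a e : A4_form a q e q = 0 by apply: A40; rewrite /= !inE eqxx ?orbT ?andbF.
have z34 a e : A4_form a e q q = 0 by apply: A40; rewrite /= !inE eqxx ?orbT ?andbF.
have -> : wsum4 b A4_form = wsum4 c (fun x y z w => A4_form x y z w
    - (A4_form q y z w + A4_form x q z w + A4_form x y q w + A4_form x y z q)).
  rewrite /wsum4 wsum_neutral; apply: eq_wsum => x.
  rewrite -!wsumB wsum_neutral; apply: eq_wsum => y.
  rewrite -!wsumB wsum_neutral; apply: eq_wsum => z.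
  rewrite -!wsumB wsum_neutral; apply: eq_wsum => w.
  by rewrite !(z12, z13, z14, z23, z24, z34); ring.
rewrite -oppr_ge0 -mulN1r -wsum4Z; do 4![apply: wsum_ge0 => // ?].
by rewrite mulN1r opprB subr_ge0 A4_form_five.
Qed.

Lemma octopus (c : T -> C) q : (forall x, 0 <= c x) ->
  0 <= qform v (weighted_transpositions
                  (fun x => c x - (x == q)%:R * \sum_y c y)).
Proof.
move=> c0; set b := fun x => _; have b0 : \sum_x b x = 0.
  have := wsum_neutral c q (fun=> 1); rewrite /wsum subrr.
  by under eq_bigr do rewrite mulr1; move->; rewrite big1 // => x _; rewrite mulr0.
have bR x : b x \is Num.real.
  rewrite rpredB ?rpredM ?realn ?ger0_real //; exact: sumr_ge0.
have b2_ge0 x : 0 <= b x ^+ 2 by rewrite -realEsqr.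
set W := weighted_transpositions b.
have W2 : 0 <= qform v (W * W).
  have W_adj : W^t* = W := weighted_transpositions_adj bR.
  by rewrite -{1}W_adj; apply: psd_sqr.
(* The identity must be divided by N, the sum of the [b x ^+ 2]; if N is 0, all weights vanish. *)
have [N0|N0] := eqVneq (\sum_x b x ^+ 2) 0.
  suff -> : W = 0 by rewrite qform0.
  rewrite /W /weighted_transpositions big1 // => x _; rewrite big1 // => y _.
  move/psumr_eq0P : N0 => /(_ (fun x _ => b2_ge0 x)) /(_ x isT)/eqP.
  by rewrite sqrf_eq0 => /eqP->; rewrite mul0r scale0r.
have N_gt0 : 0 < \sum_x b x ^+ 2 by rewrite lt0r N0 sumr_ge0.
rewrite -(pmulr_rge0 _ N_gt0) -(pmulrn_lge0 _ (isT : 0 < 12)%N) wsum4_A4_form //.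
by rewrite subr_ge0 (le_trans (wsum4_A4_form_le0 q c0)) // mulrn_wge0.
Qed.

End Octopus.

(** * Symmetrizers and the gap of the complete graph *)

Section Projections.
Local Open Scope sesquilinear_scope.
Variables (C : numClosedFieldType) (T : finType) (d : nat).
Variable rho : mx_representation C [set: {perm T}] d.
Hypothesis rhoU : forall s, rho s \is unitarymx.
Implicit Types (x y q : T) (s : {perm T}) (A B : {set T}) (v : 'cV[C]_d).

Definition transp_form v x y := qform v (1 - rho (tperm x y)).

(** The customary form of the octopus inequality; the factor 2 appears because the left-hand side
    runs over ordered pairs. *)
Lemma octopus_transp (c : T -> C) q v : (forall x, 0 <= c x) ->
  wsum c (fun x => wsum c (transp_form v x)) <=
  (\sum_x c x) * wsum c (transp_form v q) *+ 2.
Proof.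
move=> c0; have := octopus rhoU v q c0; rewrite qform_weighted.
have tC x y : transp_form v x y = transp_form v y x by rewrite /transp_form tpermC.
suff -> : wsum c (fun x => wsum c (transp_form v x)) =
   (\sum_x c x) * wsum c (transp_form v q) *+ 2 -
   wsum (fun x => c x - (x == q)%:R * \sum_y c y) (fun x =>
     wsum (fun x => c x - (x == q)%:R * \sum_y c y)
       (fun y => qform v (rho (tperm x y)))).
  by move=> H; rewrite gerBl.
rewrite wsum_neutral mulr2n.
have -> : (\sum_x c x) * wsum c (transp_form v q) =
   wsum c (fun x => wsum c (fun y => transp_form v q y)) by rewrite wsum_const.
rewrite [X in X + _ - _]wsumC -wsumD -wsumB; apply: eq_wsum => x.
rewrite -wsumD -wsumB wsum_neutral -wsumB; apply: eq_wsum => y.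
rewrite (tpermC x q) tperm1 /transp_form !qformB -(rho1 rho).
by ring.
Qed.

Definition sym_proj A : 'M[C]_d :=
  (#|A|`!%:R)^-1 *: \sum_(s in Sym A) rho s.

Lemma mem_Sym A s : (s \in Sym A) = perm_on A s.
Proof. by rewrite inE. Qed.

Lemma fact_neq0 n : (n`!%:R : C) != 0.
Proof. by rewrite pnatr_eq0 -lt0n fact_gt0. Qed.

Lemma sym_proj_adj A : (sym_proj A)^t* = sym_proj A.
Proof.
rewrite /sym_proj adjmxZ adjmx_sum; congr (_ *: _).
  by rewrite fmorphV rmorph_nat.
rewrite (reindex_inj invg_inj) /=; apply: eq_big => s.
  by rewrite groupV.
by rewrite rho_adj // invgK.
Qed.

Lemma rho_sym_proj A s : perm_on A s -> rho s * sym_proj A = sym_proj A.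
Proof.
move=> sA; rewrite /sym_proj -mulmxE -scalemxAr; congr (_ *: _).
rewrite mulmx_sumr [RHS](reindex_inj (mulgI s)) /=; apply: eq_big => u.
  by rewrite groupMl // mem_Sym.
by rewrite rhoM.
Qed.

Lemma sym_proj_rho A s : perm_on A s -> sym_proj A * rho s = sym_proj A.
Proof.
move=> sA; rewrite /sym_proj -mulmxE -scalemxAl; congr (_ *: _).
rewrite mulmx_suml [RHS](reindex_inj (mulIg s)) /=; apply: eq_big => u.
  by rewrite groupMr // mem_Sym.
by rewrite rhoM.
Qed.

Lemma sym_proj_mulr A B : A \subset B -> sym_proj B * sym_proj A = sym_proj B.
Proof.
move=> AB; rewrite {2}/sym_proj -mulmxE -scalemxAr mulmx_sumr.
under eq_bigr => s sA.
  rewrite mulmxE sym_proj_rho; last first.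
    by apply: subset_trans AB; move: sA; rewrite mem_Sym.
over.
by rewrite sumr_const card_Sym -scaler_nat scalerA mulVf ?fact_neq0 ?scale1r.
Qed.

Lemma sym_proj_mull A B : A \subset B -> sym_proj A * sym_proj B = sym_proj B.
Proof.
move=> /sym_proj_mulr/(congr1 (fun M : 'M_d => M^t*)).
by rewrite -!mulmxE adjmxM !sym_proj_adj.
Qed.

Lemma sym_projC A B : [disjoint A & B] ->
  sym_proj A * sym_proj B = sym_proj B * sym_proj A.
Proof.
move=> AB; rewrite /sym_proj -!mulmxE -!(scalemxAl, scalemxAr) !scalerA mulrC.
congr (_ *: _); rewrite mulmx_suml mulmx_sumr; apply: eq_bigr => s sA.
rewrite mulmx_sumr mulmx_suml; apply: eq_bigr => u uB.
rewrite !mulmxE -!rhoM (perm_onC _ _ AB) -?mem_Sym //.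
Qed.

Lemma sym_proj0 : sym_proj set0 = 1.
Proof.
rewrite /sym_proj cards0 fact0 invr1 scale1r (big_pred1 1%g) ?rho1 // => s.
rewrite mem_Sym; apply/idP/eqP => [s0|->]; last exact: perm_on1.
by apply: perm_on_id s0 _; rewrite cards0.
Qed.

(** A difference of nested orthogonal projections is itself an orthogonal projection. *)
Lemma sym_proj_sub_psd A B : A \subset B -> psd (sym_proj A - sym_proj B).
Proof.
move=> AB.
have -> : sym_proj A - sym_proj B =
    (sym_proj A - sym_proj B)^t* * (sym_proj A - sym_proj B).
  rewrite adjmxB !sym_proj_adj !(mulrBl, mulrBr).
  by rewrite (sym_proj_mulr AB) (sym_proj_mull AB) !sym_proj_mulr // subrr subr0.
exact: psd_sqr.
Qed.

Lemma sym_proj_compl_psd A : psd (1 - sym_proj A).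
Proof. by rewrite -sym_proj0; apply/sym_proj_sub_psd/sub0set. Qed.

(** Coset decomposition: a permutation of [q |: A] taking q to x is uniquely one of A followed by
    [tperm q x]. *)
Lemma sym_proj_setU1 A q : q \notin A ->
  sym_proj (q |: A) *+ #|A|.+1 = sym_proj A * (1 + \sum_(x in A) rho (tperm q x)).
Proof.
move=> qA; have cA : #|q |: A| = #|A|.+1 by rewrite cardsU1 qA.
transitivity (sym_proj A * \sum_(x in q |: A) rho (tperm q x)); last first.
  by rewrite big_setU1 //= tperm1 rho1.
rewrite /sym_proj cA -mulmxE -scalemxAl -scaler_nat scalerA factS natrM invfM.
rewrite mulrA divff ?pnatr_eq0 // mul1r; congr (_ *: _).
rewrite mulmx_sumr.
rewrite (partition_big (fun s : {perm T} => s q) (mem (q |: A))) /=; last first.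
  by move=> s; rewrite mem_Sym => sA; rewrite perm_closed // setU11.
apply: eq_bigr => x xA; rewrite mulmx_suml.
rewrite (reindex_inj (mulIg (tperm q x))) /=; apply: eq_big => s; last by rewrite rhoM.
have tA : perm_on (q |: A) (tperm q x).
  by apply: subset_trans (tperm_on _ _) _; rewrite subUset !sub1set setU11.
rewrite groupMr ?mem_Sym // permM.
apply/andP/idP => [[sA /eqP sq]|sA]; last first.
  split; first by apply: subset_trans sA _; rewrite subsetUr.
  by rewrite (out_perm sA qA) tpermL.
have {}sq : s q = q by apply: (@perm_inj _ (tperm q x)); rewrite sq tpermL.
apply/subsetP => y sy; have := subsetP sA y sy; rewrite in_setU1 => /orP[/eqP yq|//].
by move: sy; rewrite inE yq sq eqxx.
Qed.

(** Over ordered pairs, so each transposition counts twice. *)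
Definition transp_laplacian A : 'M[C]_d :=
  \sum_(x in A) \sum_(y in A) (1 - rho (tperm x y)).

Definition star_laplacian q A : 'M[C]_d := \sum_(x in A) (1 - rho (tperm q x)).

Lemma transp_laplacian_setU1 A q : q \notin A ->
  transp_laplacian (q |: A) = transp_laplacian A + star_laplacian q A *+ 2.
Proof.
move=> qA; rewrite /transp_laplacian big_setU1 //= big_setU1 //=.
rewrite tperm1 rho1 subrr add0r.
under [X in _ + X]eq_bigr do rewrite big_setU1 //= tpermC.
by rewrite [X in _ + X]big_split /= mulr2n addrA addrC.
Qed.

Lemma transp_laplacian_mulr A : transp_laplacian A * sym_proj A = 0.
Proof.
rewrite mulr_suml big1 // => x xA; rewrite mulr_suml big1 // => y yA.
rewrite mulrBl mul1r rho_sym_proj ?subrr //.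
by apply: subset_trans (tperm_on _ _) _; rewrite subUset !sub1set xA.
Qed.

Lemma star_laplacian_mull A q : q \notin A ->
  sym_proj A * star_laplacian q A = (sym_proj A - sym_proj (q |: A)) *+ #|A|.+1.
Proof.
move=> qA; rewrite /star_laplacian sumrB mulrBr sumr_const mulrnBl sym_proj_setU1 //.
by rewrite mulrDr mulr1 mulrnAr mulr1 mulrSr; mx_linear.
Qed.

Lemma star_laplacian_mulr A q : q \notin A ->
  star_laplacian q A * sym_proj A = (sym_proj A - sym_proj (q |: A)) *+ #|A|.+1.
Proof.
move=> /star_laplacian_mull/(congr1 (fun M : 'M_d => M^t*)).
rewrite -!mulmxE adjmxM adjmxMn adjmxB !sym_proj_adj => <-; congr (_ *m _).
rewrite adjmx_sum; apply: eq_bigr => x _.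
by rewrite adjmxB adjmx1 tpermV_adj.
Qed.

Lemma transp_laplacian_adj A : (transp_laplacian A)^t* = transp_laplacian A.
Proof.
rewrite adjmx_sum; apply: eq_bigr => x _; rewrite adjmx_sum; apply: eq_bigr => y _.
by rewrite adjmxB adjmx1 tpermV_adj.
Qed.

(** The octopus inequality with weight 1 on A and 0 elsewhere. *)
Lemma star_octopus A q v :
  qform v (transp_laplacian A) <= qform v (star_laplacian q A) *+ #|A| *+ 2.
Proof.
have sumE (F : T -> C) : wsum (fun x => (x \in A)%:R) F = \sum_(x in A) F x.
  rewrite /wsum [RHS]big_mkcond /=; apply: eq_bigr => x _.
  by case: (x \in A); rewrite ?mul1r ?mul0r.
have := @octopus_transp (fun x => (x \in A)%:R) q v (fun x => ler0n _ _).
rewrite (eq_wsum _ (fun x => sumE (transp_form v x))) !sumE.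
have -> : \sum_x (x \in A)%:R = #|A|%:R :> C.
  by rewrite -sum1_card natr_sum [RHS]big_mkcond; apply: eq_bigr => x _; case: ifP.
rewrite mulr_natl /star_laplacian /transp_laplacian !qform_sum.
by under [X in _ -> X <= _]eq_bigr do rewrite qform_sum.
Qed.

(* For A = q |: B with |B| = m, the Laplacian commutes with Q = P_B and equals
   2 (m + 1) (Q - P_A) on the image of Q.  On the kernel of Q the octopus
   inequality bounds the star at q below by the Laplacian of B over 2 m. *)
Lemma transp_laplacian_gap A v :
  qform v (1 - sym_proj A) *+ #|A| *+ 2 <= qform v (transp_laplacian A).
Proof.
elim: {A}#|A| {-2}A (erefl #|A|) v => [|m IH] A cA v.
  by rewrite (cards0_eq cA) /transp_laplacian big_set0 qform0 cards0 mulr0n mul0rn.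
have [q qA] : {q | q \in A} by apply/sigW/card_gt0P; rewrite cA.
have cB : #|A :\ q| = m by move: cA; rewrite (cardsD1 q) qA => -[].
have qB : q \notin A :\ q by rewrite !inE eqxx.
rewrite cA -(setD1K qA); move: (A :\ q) cB qB => B cB qB {A cA qA}.
set Q := sym_proj B; set P := sym_proj _; set L := transp_laplacian _.
have QQ : Q * Q = Q by apply: sym_proj_mulr.
have QP : Q * P = P by apply: sym_proj_mull; apply: subsetUr.
have PQ : P * Q = P by apply: sym_proj_mulr; apply: subsetUr.
have LQ : L * Q = (Q - P) *+ m.+1 *+ 2.
  rewrite /L transp_laplacian_setU1 // mulrDl transp_laplacian_mulr add0r.
  by rewrite mulrnAl star_laplacian_mulr // cB.
have QL : Q * L = (Q - P) *+ m.+1 *+ 2.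
  have := congr1 (fun M : 'M_d => M^t*) LQ.
  rewrite -!mulmxE adjmxM !adjmxMn adjmxB !sym_proj_adj => <-.
  by rewrite /L transp_laplacian_adj.
set w := (1 - Q) *m v.
have Q_adj : Q^t* = Q by apply: sym_proj_adj.
have compl_adj : (1 - Q)^t* = 1 - Q by rewrite adjmxB adjmx1 Q_adj.
have wE M : qform w M = qform v ((1 - Q) * M * (1 - Q)).
  by rewrite -{1}compl_adj qform_conj.
have Lv : qform v L = qform w L + qform v (Q - P) *+ m.+1 *+ 2.
  rewrite wE -!qformMn -qformD !(mulrBl, mulrBr) !(mulr1, mul1r) QL LQ.
  rewrite !mulrnAl mulrBl QQ PQ; congr (qform v _).
  by mx_linear.
have Pv : qform v (1 - P) = qform w 1 + qform v (Q - P).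
  rewrite wE -qformD !(mulrBl, mulrBr) !(mulr1, mul1r) QQ; congr (qform v _).
  by mx_linear.
rewrite Pv Lv !mulrnDl lerD2r.
(* The octopus bound is divided by m below; for m = 0 the set B is empty, Q is the identity and w =
   0. *)
have [m0|m_gt0] := posnP m.
  have -> : w = 0.
    move: cB; rewrite m0 => /cards0_eq B0.
    by rewrite /w /Q B0 sym_proj0 subrr mul0mx.
  have form0 M : qform (0 : 'cV[C]_d) M = 0 by rewrite /qform mulmx0 mxE.
  by rewrite !form0 !mul0rn.
have wQ : qform w (1 - Q) = qform w 1.
  rewrite !wE; congr (qform v _); rewrite !(mulrBl, mulrBr) !(mulr1, mul1r) !QQ.
  by mx_linear.
have := IH B cB w; rewrite -/Q wQ cB => lower.
have := star_octopus B q w; rewrite cB => upper.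
(* Cancelling 2 m shows that the star at q is at least the squared norm on w; twice the star raises
   the factor 2 m of the Laplacian of B to 2 (m + 1). *)
have /(le_trans lower) := upper; rewrite !lerMn2r (gtn_eqF m_gt0) /= => le1J.
rewrite /L transp_laplacian_setU1 // qformD qformMn [_ *+ m.+1]mulrSr mulrnDl.
by rewrite lerD // lerMn2r.
Qed.

End Projections.

(** * Reduction from blocks to points *)

(** The difference of the two sums consists of the [c i * c k * (N i k + N k i)] with i different
    from k. *)
Lemma quadratic_sum_erase (C : numDomainType) (I : finType) (c c' : I -> C)
    (N : I -> I -> C) (k : I) :
  (forall i, 0 <= c i) -> N k k = 0 -> (forall i, i != k -> 0 <= N i k + N k i) ->
  (forall i, c' i = if i == k then 0 else c i) ->
  \sum_i \sum_j c' i * c' j * N i j <= \sum_i \sum_j c i * c j * N i j.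
Proof.
move=> c0 Nkk Nk c'E; rewrite -subr_ge0 -sumrB (bigD1 k) //=.
rewrite -sumrB (bigD1 k) //= {1}c'E eqxx !mul0r subr0 Nkk mulr0 add0r.
have -> : \sum_(i | i != k) (\sum_j c i * c j * N i j - \sum_j c' i * c' j * N i j)
    = \sum_(i | i != k) c i * c k * N i k.
  apply: eq_bigr => i ik; rewrite -sumrB (bigD1 k) //= big1 => [|j jk].
    by rewrite (c'E k) eqxx mulr0 mul0r subr0 addr0.
  by rewrite !c'E (negPf ik) (negPf jk) subrr.
rewrite -big_split /=; apply: sumr_ge0 => i ik.
rewrite {1}c'E eqxx !mul0r subr0 (mulrC (c k)) -mulrDr addrC.
by rewrite mulr_ge0 ?mulr_ge0 ?Nk.
Qed.

Section Blocks.
Local Open Scope sesquilinear_scope.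
Variables (C : numClosedFieldType) (T I : finType) (d : nat).
Variable rho : mx_representation C [set: {perm T}] d.
Hypothesis rhoU : forall s, rho s \is unitarymx.
Variables (q : T) (A : I -> {set T}).
Hypothesis qA : forall i, q \notin A i.
Hypothesis disjA : forall i j, i != j -> [disjoint A i & A j].
Implicit Types (B : {set T}) (v w : 'cV[C]_d) (c : I -> C) (i j k : I).

Local Notation P := (sym_proj rho).

Definition block_laplacian B := (1 - P B) *+ #|B|.

Local Notation al := block_laplacian.

Lemma block_laplacian_incr_psd B : q \notin B -> psd (al (q |: B) - al B).
Proof.
move=> qB; have -> : al (q |: B) - al B = (1 - P B) + (P B - P (q |: B)) *+ #|B|.+1.
  by rewrite /al cardsU1 qB add1n !mulrSr !mulrnBl; mx_linear.
move=> v; rewrite qformD qformMn addr_ge0 ?mulrn_wge0 ?sym_proj_compl_psd //.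
by apply: sym_proj_sub_psd => //; apply: subsetUr.
Qed.

Lemma card_blockU i j : i != j -> #|A i :|: A j| = (#|A i| + #|A j|)%N.
Proof. by move=> ij; rewrite cardsU disjoint_setI0 ?cards0 ?subn0 // disjA. Qed.

Lemma block_laplacianC k B : A k \subset B \/ [disjoint A k & B] ->
  P (A k) * al B = al B * P (A k).
Proof.
move=> kB; rewrite /al mulrnAr mulrnAl mulrBr mulrBl mulr1 mul1r.
by case: kB => kB; [rewrite sym_proj_mull // sym_proj_mulr | rewrite sym_projC].
Qed.

(* Twice the difference of the two sides of the theorem is the sum of
   c_i c_j pair_term i j over all i, j; the last summand corrects the diagonal. *)
Definition pair_term i j := (al (q |: A j) - al (A j)) *+ #|A i| *+ 2
  - (al (A i :|: A j) - al (A i) - al (A j)) - al (A i) *+ (3 * (i == j)).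

Lemma block_cases k j : A k \subset A j \/ [disjoint A k & A j].
Proof.
by have [->|kj] := eqVneq k j; [left | right; apply: disjA].
Qed.

(** Each set occurring in [pair_term i j] contains [A k] or is disjoint from it. *)
Lemma pair_termC k i j : P (A k) * pair_term i j = pair_term i j * P (A k).
Proof.
have hq : P (A k) * al (q |: A j) = al (q |: A j) * P (A k).
  apply: block_laplacianC; case: (block_cases k j) => [s|dj]; [left|right].
    exact: subset_trans s (subsetUr _ _).
  by rewrite disjoints_subset setCU subsetI -!disjoints_subset disjoint_sym disjoints1 qA.
have hU : P (A k) * al (A i :|: A j) = al (A i :|: A j) * P (A k).
  apply: block_laplacianC; case: (block_cases k j) => [s|dj].
    by left; apply: subset_trans s (subsetUr _ _).
  case: (block_cases k i) => [s|di]; [left|right].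
    exact: subset_trans s (subsetUl _ _).
  by rewrite disjoints_subset setCU subsetI -!disjoints_subset di.
move: (block_laplacianC (block_cases k i)) (block_laplacianC (block_cases k j)) hq hU.
rewrite /pair_term; move: (al _) (al _) (al _) (al _) => a1 a2 a3 a4 h1 h2 h3 h4.
by rewrite !(mulrBl, mulrBr, mulrnAl, mulrnAr) h1 h2 h3 h4.
Qed.

(** The cross terms vanish because [pair_term] commutes with the self-adjoint projection
    [P (A k)]. *)
Lemma qform_split k v i j : let w := P (A k) *m v in
  qform v (pair_term i j) = qform w (pair_term i j) + qform (v - w) (pair_term i j).
Proof.
move=> /=; have PP : P (A k) * P (A k) = P (A k) by apply: sym_proj_mulr.
have Padj := sym_proj_adj rhoU (A k).
have -> : v - P (A k) *m v = (1 - P (A k)) *m v by rewrite mulmxBl mul1mx.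
rewrite -!qform_conj -qformD adjmxB adjmx1 Padj; congr (qform v _).
move: (pair_term i j) (pair_termC k i j) => M PM.
by rewrite !(mulrBl, mulrBr) !mulr1 !mul1r PM -!mulrA PP; mx_linear.
Qed.

Lemma qform_mulr v M N : N *m v = v -> qform v (M * N) = qform v M.
Proof. by move=> Nv; rewrite /qform -mulmxE mulmxA -(mulmxA _ N) Nv. Qed.

Lemma qform_mulr0 v M N : N *m v = 0 -> qform v (M * N) = 0.
Proof. by move=> Nv; rewrite /qform -mulmxE mulmxA -(mulmxA _ N) Nv mulmx0 mxE. Qed.

Lemma qform_killed v k B : P (A k) *m v = 0 -> A k \subset B -> qform v (P B) = 0.
Proof. by move=> v0 kB; rewrite -(sym_proj_mulr rho kB) qform_mulr0. Qed.

Lemma block_laplacian_killed v k B : P (A k) *m v = 0 -> A k \subset B ->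
  qform v (al B) = qform v 1 *+ #|B|.
Proof. by move=> v0 kB; rewrite qformMn qformB (qform_killed v0 kB) subr0. Qed.

Lemma qform_pair_term v i j : qform v (pair_term i j) =
  (qform v (al (q |: A j)) - qform v (al (A j))) *+ #|A i| *+ 2
  - (qform v (al (A i :|: A j)) - qform v (al (A i)) - qform v (al (A j)))
  - qform v (al (A i)) *+ (3 * (i == j)).
Proof.
rewrite /pair_term; move: (al _) (al _) (al _) (al _) => a1 a2 a3 a4.
by rewrite !(qformB, qformMn).
Qed.

(** With a the size of [A k], the multiples of [qform v 1] are 2a + a - 3a. *)
Lemma pair_term_diag_killed v k : P (A k) *m v = 0 -> qform v (pair_term k k) = 0.
Proof.
move=> v0; have killed := block_laplacian_killed v0.
rewrite qform_pair_term eqxx setUid !killed ?subsetUr // cardsU1 qA add1n muln1.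
by move: (qform v 1) => z; ring.
Qed.

(** Sets containing [A k] contribute multiples of [qform v 1], which cancel; two positive operators
    attached to [A i] remain. *)
Lemma pair_term_killed v k i : i != k -> P (A k) *m v = 0 ->
  0 <= qform v (pair_term i k) + qform v (pair_term k i).
Proof.
move=> ik v0; have ki : k != i by rewrite eq_sym.
have -> : qform v (pair_term i k) + qform v (pair_term k i) =
    qform v (1 - P (A i)) *+ #|A i| *+ 2
    + qform v (al (q |: A i) - al (A i)) *+ #|A k| *+ 2.
  have killed := block_laplacian_killed v0.
  have complE : qform v (1 - P (A i)) *+ #|A i| = qform v (al (A i)) by rewrite -qformMn.
  rewrite complE !qform_pair_term [X in _ + X *+ _ *+ 2]qformB (negPf ik) (negPf ki).
  rewrite (setUC (A k)).
  rewrite (killed _ (subsetUr (A i) _)) (killed _ (subsetUr [set q] _)).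
  rewrite (killed _ (subxx _)) card_blockU // cardsU1 qA add1n !muln0.
  move: (qform v 1) (qform v (al _)) (qform v (al _)) => z1 z2 z3.
  by ring.
rewrite addr_ge0 // mulrn_wge0 // mulrn_wge0 ?sym_proj_compl_psd //.
exact: block_laplacian_incr_psd.
Qed.

Lemma block_laplacian_fixed v B : P B *m v = v -> qform v (al B) = 0.
Proof.
by move=> Bv; rewrite /al qformMn qformB -[P B]mul1r qform_mulr // subrr mul0rn.
Qed.

Lemma star_fixed v B : q \notin B -> P B *m v = v ->
  qform v (star_laplacian rho q B) = qform v (al (q |: B)).
Proof.
move=> qB Bv; rewrite -(qform_mulr _ Bv) star_laplacian_mulr // /al cardsU1 qB add1n.
by rewrite !qformMn !qformB -[P B]mul1r qform_mulr.
Qed.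

Let block_sum v i j := \sum_(x in A i) \sum_(y in A j) transp_form rho v x y.

Lemma transp_form_sym v x y : transp_form rho v x y = transp_form rho v y x.
Proof. by rewrite /transp_form tpermC. Qed.

Lemma block_sumC v i j : block_sum v i j = block_sum v j i.
Proof.
rewrite /block_sum exchange_big; apply: eq_bigr => x _; apply: eq_bigr => y _.
exact: transp_form_sym.
Qed.

Lemma qform_transp_laplacian v B : qform v (transp_laplacian rho B) =
  \sum_(x in B) \sum_(y in B) transp_form rho v x y.
Proof. by rewrite qform_sum; apply: eq_bigr => x _; rewrite qform_sum. Qed.

Lemma block_sum_diag v i : P (A i) *m v = v -> block_sum v i i = 0.
Proof.
move=> iv; rewrite /block_sum -qform_transp_laplacian -(qform_mulr _ iv).
by rewrite transp_laplacian_mulr qform0.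
Qed.

(** On such v the operators [al (A i)] and [al (A j)] vanish and [al (q |: A j)] is the star. The
    gap bounds [al (A i :|: A j)] by half the Laplacian of the union, which for distinct i and j is
    the mixed block sum. *)
Lemma pair_term_fixed v i j : P (A i) *m v = v -> P (A j) *m v = v ->
  qform v (star_laplacian rho q (A j)) *+ #|A i| *+ 2 - block_sum v i j
  <= qform v (pair_term i j).
Proof.
move=> iv jv; rewrite qform_pair_term (block_laplacian_fixed iv).
rewrite (block_laplacian_fixed jv) !subr0 mul0rn subr0 star_fixed // lerD2l lerN2.
have [<-|ij] := eqVneq i j.
  by rewrite setUid block_laplacian_fixed // block_sum_diag.
have sumU (F : T -> C) : \sum_(x in A i :|: A j) F x =
    \sum_(x in A i) F x + \sum_(x in A j) F x.
  by rewrite -bigU ?disjA //; apply: eq_bigl => x; rewrite !inE.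
have blockE : qform v (transp_laplacian rho (A i :|: A j)) = block_sum v i j *+ 2.
  rewrite qform_transp_laplacian; under eq_bigr do rewrite sumU.
  rewrite big_split /= !sumU -!/(block_sum _ _ _) !block_sum_diag //.
  by rewrite add0r addr0 (block_sumC _ j i).
have := transp_laplacian_gap rhoU (A i :|: A j) v.
by rewrite blockE lerMn2r -qformMn.
Qed.

Let weight c x := \sum_i c i * (x \in A i)%:R.

Lemma wsum_weight c (F : T -> C) :
  wsum (weight c) F = \sum_i c i * \sum_(x in A i) F x.
Proof.
rewrite /wsum /weight; under eq_bigr do rewrite mulr_suml.
rewrite exchange_big; apply: eq_bigr => i _; rewrite mulr_sumr [RHS]big_mkcond.
by apply: eq_bigr => x _; case: (x \in A i); rewrite ?mulr1 ?mulr0 ?mul0r.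
Qed.

(** The octopus inequality for the point weights [c i] on [A i]. *)
Lemma block_octopus c v : (forall i, 0 <= c i) ->
  \sum_i \sum_j c i * c j * block_sum v i j <=
  \sum_i \sum_j c i * c j * (qform v (star_laplacian rho q (A j)) *+ #|A i| *+ 2).
Proof.
move=> c0; have w0 x : 0 <= weight c x by apply: sumr_ge0 => i _; rewrite mulr_ge0.
have := octopus_transp rhoU q v w0; rewrite !wsum_weight.
have -> : \sum_x weight c x = \sum_i c i * #|A i|%:R.
  have := wsum_weight c (fun=> 1); rewrite /wsum; under eq_bigr do rewrite mulr1.
  by move->; apply: eq_bigr => i _; rewrite sumr_const.
set L := (X in X <= _); set R := (X in _ <= X) => LR.
have -> : \sum_i \sum_j c i * c j * block_sum v i j = L.
  apply: eq_bigr => i _; under [X in _ = _ * X]eq_bigr do rewrite wsum_weight.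
  rewrite exchange_big mulr_sumr; apply: eq_bigr => j _.
  by rewrite -mulr_sumr mulrA.
have -> //: \sum_i \sum_j c i * c j *
   (qform v (star_laplacian rho q (A j)) *+ #|A i| *+ 2) = R.
rewrite /R mulr_suml -sumrMnl; apply: eq_bigr => i _.
rewrite mulr_sumr -sumrMnl; apply: eq_bigr => j _.
by rewrite /star_laplacian qform_sum; ring.
Qed.

Lemma pair_term_sum_fixed c v : (forall i, 0 <= c i) ->
  (forall i, c i = 0 \/ P (A i) *m v = v) ->
  0 <= \sum_i \sum_j c i * c j * qform v (pair_term i j).
Proof.
move=> c0 cv; have := block_octopus v c0; rewrite -subr_ge0 => /le_trans; apply.
rewrite -sumrB; apply: ler_sum => i _; rewrite -sumrB; apply: ler_sum => j _.
rewrite -mulrBr; case: (cv i) => [->|iv]; first by rewrite !mul0r.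
case: (cv j) => [->|jv]; first by rewrite !mulr0 !mul0r.
by rewrite ler_wpM2l ?mulr_ge0 // pair_term_fixed.
Qed.

(** Induction on the list of blocks still to be treated; every other block has weight 0 or fixes v.
    Treating k splits v into its components in the image and the kernel of [P (A k)]. *)
Lemma pair_term_sum_ge0 c v : (forall i, 0 <= c i) ->
  0 <= \sum_i \sum_j c i * c j * qform v (pair_term i j).
Proof.
move=> c0; have : forall i, i \in enum I \/ (c i = 0 \/ P (A i) *m v = v).
  by move=> i; left; rewrite mem_enum.
elim: (enum I) c c0 v => [|k s IH] c c0 v hs.
  by apply: pair_term_sum_fixed => // i; case: (hs i).
set w := P (A k) *m v.
have PC i : P (A i) * P (A k) = P (A k) * P (A i).
  by have [->//|ik] := eqVneq i k; rewrite sym_projC // disjA.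
have fixw i : P (A i) *m v = v -> P (A i) *m w = w.
  by move=> iv; rewrite /w mulmxA [_ *m P _]PC -mulmxA iv.
have -> : \sum_i \sum_j c i * c j * qform v (pair_term i j) =
   \sum_i \sum_j c i * c j * qform w (pair_term i j)
   + \sum_i \sum_j c i * c j * qform (v - w) (pair_term i j).
  rewrite -big_split; apply: eq_bigr => i _; rewrite -big_split; apply: eq_bigr => j _.
  by rewrite /= -mulrDr -qform_split.
apply: addr_ge0.
  apply: IH => // i; case: (hs i) => [|[ci|iv]]; last 2 first.
  - by right; left.
  - by right; right; apply: fixw.
  rewrite inE => /orP[/eqP->|]; last by left.
  right; right; rewrite /w mulmxA; congr (_ *m _).
  exact: sym_proj_mulr.
have vw0 : P (A k) *m (v - w) = 0.
  by rewrite mulmxBr /w mulmxA [_ *m P _]sym_proj_mulr // subrr.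
(* On the kernel component, erasing the weight of k only lowers the sum. *)
pose c' i := if i == k then 0 else c i.
have c'0 i : 0 <= c' i by rewrite /c'; case: ifP.
have : 0 <= \sum_i \sum_j c' i * c' j * qform (v - w) (pair_term i j).
  apply: IH => // i; rewrite /c'; have [|ik] := eqVneq i k; first by right; left.
  case: (hs i) => [|[ci|iv]]; last 2 first.
  - by right; left.
  - by right; right; rewrite mulmxBr fixw // iv.
  by rewrite inE (negPf ik); left.
move/le_trans; apply; apply: quadratic_sum_erase => // [|i ik].
  exact: pair_term_diag_killed.
exact: pair_term_killed.
Qed.

End Blocks.

(** * From ordered pairs back to pairs i < j *)

Lemma sum_ltn_sym (V : zmodType) (t : nat) (F : 'I_t -> 'I_t -> V) :
  (forall i j, F i j = F j i) ->
  (\sum_(i < t) \sum_(j < t | (i < j)%N) F i j) *+ 2 =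
  \sum_i \sum_j F i j - \sum_i F i i.
Proof.
move=> FC; rewrite mulr2n {2}(exchange_big_dep xpredT) //= -big_split -sumrB.
apply: eq_bigr => i _; rewrite [in RHS](bigD1 i) //= [RHS]addrAC subrr add0r.
rewrite [RHS](bigID (fun j : 'I_t => (i < j)%N)) /=; congr (_ + _).
  by apply: eq_bigl => j; rewrite -(inj_eq val_inj) /=; case: ltngtP.
apply: eq_big => j; last by rewrite FC.
by rewrite -(inj_eq val_inj) /=; case: ltngtP.
Qed.

(** Doubling turns the sum over i < j into the full sum of F minus its diagonal. As [F i i] is
    [- (c i ^+ 2 * y i)], the squares occur 2 + 1 = 3 times. *)
Lemma pair_sum_ltn (K : comNzRingType) (t : nat) (c : 'I_t -> K) (a : 'I_t -> nat)
    (x y : 'I_t -> K) (z : 'I_t -> 'I_t -> K) :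
  (forall i j, z i j = z j i) -> (forall i, z i i = y i) ->
  ((\sum_i c i * (a i)%:R) * (\sum_j c j * (x j - y j))
   - (\sum_i c i ^+ 2 * y i
      + \sum_(i < t) \sum_(j < t | (i < j)%N) c i * c j * (z i j - y i - y j))) *+ 2
  = \sum_i \sum_j c i * c j * ((x j - y j) *+ a i *+ 2 - (z i j - y i - y j)
                               - y i *+ (3 * (i == j))).
Proof.
move=> zC zD; pose F i j := c i * c j * (z i j - y i - y j).
have FC i j : F i j = F j i by rewrite /F zC; ring.
have FD i : F i i = - (c i ^+ 2 * y i) by rewrite /F zD; ring.
set S := \sum_i c i ^+ 2 * y i; set L := _ * (\sum_j _).
have sumFD : \sum_i F i i = - S by rewrite -sumrN; apply: eq_bigr.
transitivity (L *+ 2 - \sum_i \sum_j F i j - S *+ 3).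
  rewrite mulrnBl mulrnDl (sum_ltn_sym FC) sumFD.
  by move: (\sum_i _) S L {sumFD} => w S L; ring.
rewrite /L /S mulr_suml -!sumrMnl -!sumrB; apply: eq_bigr => i _.
rewrite mulr_sumr -sumrMnl.
have -> : c i ^+ 2 * y i *+ 3 = \sum_j c i * c j * (y i *+ (3 * (i == j))).
  rewrite (bigD1 i) //= eqxx muln1 big1 ?addr0 => [|j /negPf ji]; first by ring.
  by rewrite eq_sym ji muln0 mulr0n mulr0.
by rewrite -!sumrB; apply: eq_bigr => j _; rewrite /F; ring.
Qed.

Lemma block_octopus_psd (C : numClosedFieldType) (T : finType) (t d : nat)
    (rho : mx_representation C [set: {perm T}] d) (q : T)
    (A : 'I_t -> {set T}) (c : 'I_t -> C) :
  (forall s, rho s \is unitarymx) -> (forall i, q \notin A i) ->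
  (forall i j, i != j -> [disjoint A i & A j]) -> (forall i, 0 <= c i) ->
  psd ((\sum_i c i * #|A i|%:R) *: (\sum_j c j *:
         (block_laplacian rho (A j :|: [set q]) - block_laplacian rho (A j)))
    - (\sum_i c i ^+ 2 *: block_laplacian rho (A i)
       + \sum_(i < t) \sum_(j < t | (i < j)%N) (c i * c j) *:
           (block_laplacian rho (A i :|: A j) - block_laplacian rho (A i)
            - block_laplacian rho (A j)))).
Proof.
move=> rhoU qA disjA c0 v; have := pair_term_sum_ge0 rhoU qA disjA v c0.
pose x j := qform v (block_laplacian rho (A j :|: [set q])).
pose y i := qform v (block_laplacian rho (A i)).
pose z i j := qform v (block_laplacian rho (A i :|: A j)).
have zC i j : z i j = z j i by rewrite /z setUC.
have zD i : z i i = y i by rewrite /z setUid.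
have termE i j : qform v (pair_term rho q A i j) =
    (x j - y j) *+ #|A i| *+ 2 - (z i j - y i - y j) - y i *+ (3 * (i == j)).
  by rewrite qform_pair_term setUC.
under eq_bigr do under eq_bigr do rewrite termE.
rewrite -(pair_sum_ltn c (fun i => #|A i|) x zC zD) pmulrn_lge0 //.
congr (0 <= _).
rewrite qformB qformD qformZ !qform_sum; congr (_ * _ - (_ + _)).
- by apply: eq_bigr => j _; rewrite qformZ [X in _ = _ * X]qformB.
- by apply: eq_bigr => i _; rewrite qformZ.
apply: eq_bigr => i _; rewrite qform_sum; apply: eq_bigr => j _.
by rewrite qformZ [X in _ = _ * X]qformB [X in _ = _ * (X - _)]qformB.
Qed.

(** * The group algebra and its action *)

Local Open Scope complex_scope.

Section GroupAlgebra.
Local Open Scope sesquilinear_scope.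
Variables (R : realType) (n : nat).
Implicit Types (a b : galg R n) (s : 'S_n) (A : {set 'I_n}).

Lemma gstarD a b : gstar (a + b) = gstar a + gstar b.
Proof. by apply/ffunP => s; rewrite !ffunE rmorphD. Qed.

Lemma gstarB a b : gstar (a - b) = gstar a - gstar b.
Proof. by apply/ffunP => s; rewrite !ffunE rmorphB. Qed.

Lemma gstar0 : gstar (0 : galg R n) = 0.
Proof. by apply/ffunP => s; rewrite !ffunE rmorph0. Qed.

(** Scalars are real because the involution is antilinear. *)
Lemma gstarZ (k : R) a : gstar (k%:C *: a) = k%:C *: gstar a.
Proof.
by apply/ffunP => s; rewrite !ffunE [LHS]rmorphM; congr (_ * _); apply: conjc_real.
Qed.

Lemma gstar_sum I (r : seq I) (P : pred I) (F : I -> galg R n) :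
  gstar (\sum_(i <- r | P i) F i) = \sum_(i <- r | P i) gstar (F i).
Proof. exact: (big_morph _ gstarD gstar0). Qed.

Lemma gstar_gbasis s : gstar (gbasis R s) = gbasis R s^-1%g.
Proof.
apply/ffunP => u; rewrite !ffunE rmorph_nat.
by rewrite -(inj_eq invg_inj) invgK.
Qed.

Lemma alpha_selfadjoint A : selfadjoint (alpha R A).
Proof.
rewrite /selfadjoint /alpha; case: ifP => _; first exact: gstar0.
have -> : ((#|A| - 1)`!%:R : R[i])^-1 = ((#|A| - 1)`!%:R^-1)%:C.
  by rewrite fmorphV rmorph_nat.
rewrite gstarZ gstar_sum; congr (_ *: _).
rewrite (reindex_inj invg_inj) /=; apply: eq_big => s; first by rewrite groupV.
by rewrite gstarB !gstar_gbasis invgK invg1.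
Qed.

Lemma selfadjointD a b : selfadjoint a -> selfadjoint b -> selfadjoint (a + b).
Proof. by move=> ha hb; rewrite /selfadjoint gstarD ha hb. Qed.

Lemma selfadjointB a b : selfadjoint a -> selfadjoint b -> selfadjoint (a - b).
Proof. by move=> ha hb; rewrite /selfadjoint gstarB ha hb. Qed.

Lemma selfadjointZ (k : R) a : selfadjoint a -> selfadjoint (k%:C *: a).
Proof. by move=> ha; rewrite /selfadjoint gstarZ ha. Qed.

Lemma selfadjoint_sum I (r : seq I) (P : pred I) (F : I -> galg R n) :
  (forall i, selfadjoint (F i)) -> selfadjoint (\sum_(i <- r | P i) F i).
Proof. by move=> hF; rewrite /selfadjoint gstar_sum; apply: eq_bigr => i _; apply: hF. Qed.

Variables (d : nat) (rho : mx_representation R[i] [set: 'S_n] d).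

Lemma repr_galgD a b : repr_galg rho (a + b) = repr_galg rho a + repr_galg rho b.
Proof. by rewrite -big_split; apply: eq_bigr => s _; rewrite ffunE scalerDl. Qed.

Lemma repr_galgZ (k : R[i]) a : repr_galg rho (k *: a) = k *: repr_galg rho a.
Proof. by rewrite scaler_sumr; apply: eq_bigr => s _; rewrite ffunE scalerA. Qed.

Lemma repr_galgB a b : repr_galg rho (a - b) = repr_galg rho a - repr_galg rho b.
Proof. by rewrite repr_galgD -scaleN1r repr_galgZ scaleN1r. Qed.

Lemma repr_galg0 : repr_galg rho 0 = 0.
Proof. by rewrite -(scale0r 0) repr_galgZ scale0r. Qed.

Lemma repr_galg_sum I (r : seq I) (P : pred I) (F : I -> galg R n) :
  repr_galg rho (\sum_(i <- r | P i) F i) = \sum_(i <- r | P i) repr_galg rho (F i).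
Proof. exact: (big_morph _ repr_galgD repr_galg0). Qed.

Lemma repr_gbasis s : repr_galg rho (gbasis R s) = rho s.
Proof.
rewrite /repr_galg (bigD1 s) //= ffunE eqxx scale1r big1 ?addr0 // => u /negPf us.
by rewrite ffunE us scale0r.
Qed.

(** The sum over [Sym A] acts as |A|! (1 - P_A), and |A|! / (|A| - 1)! = |A|. For empty A both sides
    are 0. *)
Lemma repr_alpha A : repr_galg rho (alpha R A) = block_laplacian rho A.
Proof.
rewrite /alpha /block_laplacian; case: ifP => [/eqP->|A0].
  by rewrite repr_galg0 cards0.
rewrite repr_galgZ repr_galg_sum.
under eq_bigr do rewrite repr_galgB !repr_gbasis.
rewrite sumrB sumr_const card_Sym rho1 /sym_proj.
have [m cA] : {m | #|A| = m.+1}.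
  by exists #|A|.-1; rewrite prednK // card_gt0 A0.
rewrite cA subn1 /= mulrnBl scalerBr; congr (_ - _).
  rewrite -[X in _ *: X]scaler_nat scalerA factS natrM mulrC mulfK ?fact_neq0 //.
  by rewrite scaler_nat.
rewrite -[RHS]scaler_nat scalerA factS natrM invfM mulrA divff ?mul1r //.
by rewrite pnatr_eq0.
Qed.

Lemma repr_galg_adj a : unitary_repr rho ->
  (repr_galg rho a)^t* = repr_galg rho (gstar a).
Proof.
move=> rhoU; rewrite adjmx_sum [RHS](reindex_inj invg_inj) /=.
by apply: eq_bigr => s _; rewrite adjmxZ rho_adj // ffunE invgK.
Qed.

End GroupAlgebra.

Theorem theorem5p2 (R : realType) (n t : nat) (hn : (1 <= n)%N)
    (ht : (1 <= t)%N) (q : 'I_n) (A : 'I_t -> {set 'I_n})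
    (hq : forall i : 'I_t, q \notin A i)
    (hA : forall i j : 'I_t, i != j -> [disjoint A i & A j])
    (c : 'I_t -> R) (hc : forall i : 'I_t, 0 <= c i) :
  let C : R := \sum_(i < t) c i * #|A i|%:R in
  galg_ge
    (C%:C *: \sum_(j < t)
       (c j)%:C *: (alpha R (A j :|: [set q]) - alpha R (A j)))
    (\sum_(i < t) (c i ^+ 2)%:C *: alpha R (A i)
     + \sum_(i < t) \sum_(j < t | (i < j)%N)
         (c i * c j)%:C *:
           (alpha R (A i :|: A j) - alpha R (A i) - alpha R (A j))).
Proof.
move=> C; set lhs := C%:C *: _; set rhs := (X in galg_ge _ X).
have aB X Y : selfadjoint (alpha R X - alpha R Y).
  exact: selfadjointB (alpha_selfadjoint R X) (alpha_selfadjoint R Y).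
have lhs_adj : selfadjoint lhs.
  by apply/selfadjointZ/selfadjoint_sum => j; apply: selfadjointZ.
have rhs_adj : selfadjoint rhs.
  apply: selfadjointD; apply: selfadjoint_sum => i.
    exact/selfadjointZ/alpha_selfadjoint.
  apply: selfadjoint_sum => j; apply/selfadjointZ/selfadjointB => //.
  exact: alpha_selfadjoint.
split=> // d rho rhoU; split.
  apply/is_hermitianmxP; rewrite expr0 scale1r.
  by rewrite [RHS]repr_galg_adj // gstarB lhs_adj rhs_adj.
move=> v {aB lhs_adj rhs_adj}; rewrite -[X in 0 <= X]/(qform v _).
have c0 i : 0 <= (c i)%:C by rewrite lecR.
(* By linearity and [repr_alpha] the claim becomes the operator inequality with weights in
   [R[i]]. *)
suff -> : repr_galg rho (lhs - rhs) =
  (\sum_i (c i)%:C * #|A i|%:R) *: (\sum_j (c j)%:C *: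
         (block_laplacian rho (A j :|: [set q]) - block_laplacian rho (A j)))
    - (\sum_i (c i)%:C ^+ 2 *: block_laplacian rho (A i)
       + \sum_(i < t) \sum_(j < t | (i < j)%N) ((c i)%:C * (c j)%:C) *:
           (block_laplacian rho (A i :|: A j) - block_laplacian rho (A i)
            - block_laplacian rho (A j))).
  exact: block_octopus_psd rhoU hq hA c0 v.
have reprB X Y : repr_galg rho (alpha R X - alpha R Y) =
    block_laplacian rho X - block_laplacian rho Y.
  by rewrite repr_galgB (repr_alpha rho X) (repr_alpha rho Y).
rewrite repr_galgB repr_galgZ repr_galgD !repr_galg_sum.
congr (_ *: _ - (_ + _)).
- by rewrite rmorph_sum; apply: eq_bigr => i _; rewrite rmorphM rmorph_nat.
- by apply: eq_bigr => j _; rewrite repr_galgZ reprB.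
- by apply: eq_bigr => i _; rewrite repr_galgZ repr_alpha rmorphXn.
apply: eq_bigr => i _; rewrite repr_galg_sum; apply: eq_bigr => j _.
rewrite repr_galgZ rmorphM; congr (_ *: _).
by rewrite [LHS]repr_galgB reprB repr_alpha.
Qed.
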